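(* Let $\Lambda$ be a lattice in $\mathbb{R}^{2d}$, let $g\in L^2(\mathbb{R}^d)$ and let $(\pi(\lambda)g)_{\lambda\in\Lambda}$ be a Gabor frame for $L^2(\mathbb{R}^d)$. Let $V:L^2(\mathbb{R}^d)\to L^2(\mathbb{R}^d)$ be a bounded bijective (linear) operator. Then the following statements are equivalent. \begin{itemize} \item[($\mathcal{A}_1$)] For every $\lambda\in\Lambda$, $V\pi(\lambda)g=\pi(\lambda)Vg$. \item[($\mathcal{A}_2$)] For every $\lambda\in\Lambda$ and every $f\in L^2(\mathbb{R}^d)$, $V\pi(\lambda)f=\pi(\lambda)Vf$ (i.e., $V$ commutes with $\pi(\lambda)$ for every $\lambda\in\Lambda$). \item[($\mathcal{A}_3$)] $V$ can be written as a Gabor frame multiplier (over $\Lambda$) with the constant symbol $(1)$. \item[($\mathcal{A}_4$)] $V^{-1}$ can be written as a Gabor frame multiplier (over $\Lambda$) with the constant symbol $(1)$. \end{itemize}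
   Context: $L^2(\mathbb{R}^d)$ is the complex Hilbert space of square-integrable functions. For $\omega,\tau\in\mathbb{R}^d$, $(E_\omega f)(x)=e^{2\pi i\omega x}f(x)$ (with $\omega x$ the dot product) and $(T_\tau f)(x)=f(x-\tau)$; for $\lambda=(\omega,\tau)\in\Lambda$, $\pi(\lambda)=E_\omega T_\tau$. A lattice $\Lambda$ in $\mathbb{R}^{2d}$ is a discrete subgroup $A\mathbb{Z}^{2d}$ with $A$ an invertible real $2d\times 2d$ matrix (not necessarily of product form). A Gabor system is a family $(\pi(\lambda)u)_{\lambda\in\Lambda}$ with $u\in L^2(\mathbb{R}^d)$; it is a Gabor frame if it is a frame for $L^2(\mathbb{R}^d)$, i.e. there are $0<A\le B<\infty$ with $A\|f\|^2\le\sum_{\lambda\in\Lambda}|\langle f,\pi(\lambda)u\rangle|^2\le B\|f\|^2$ for all $f$. A Gabor frame multiplier over $\Lambda$ with constant symbol $(1)$ is an operator $M_{(1),(\pi(\lambda)v)_{\lambda\in\Lambda},(\pi(\lambda)u)_{\lambda\in\Lambda}}f=\sum_{\lambda\in\Lambda}\langle f,\pi(\lambda)u\rangle\,\pi(\lambda)v$, where $u,v\in L^2(\mathbb{R}^d)$ and both $(\pi(\lambda)u)_{\lambda\in\Lambda}$ and $(\pi(\lambda)v)_{\lambda\in\Lambda}$ are Gabor frames (inner product linear in the first argument). *)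

(* Defs.v *)
From HB Require Import structures.
From mathcomp Require Import all_boot all_order all_algebra.
From mathcomp Require Import ring_quotient generic_quotient.
From mathcomp Require Import all_classical all_reals all_analysis measurable_realfun.
From mathcomp Require Import summability.
From mathcomp Require Import complex lra.

Set Implicit Arguments.
Unset Strict Implicit.
Unset Printing Implicit Defensive.
Import Order.TTheory GRing.Theory Num.Theory.
Import numFieldNormedType.Exports.

Local Open Scope classical_set_scope.
Local Open Scope ring_scope.

(* R^n is the type of column vectors 'cV[R]_n, with the sigma-algebra generated
   by the coordinate maps (the Borel sigma-algebra). *)
Section measurable_cV.
Variables (R : realType) (d : nat).

Let coor (i : 'I_d) (x : 'cV[R]_d) : measurableTypeR R := x i 0.

Let cV_set0 : g_sigma_preimage coor set0.
Proof. exact: sigma_algebra0. Qed.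

Let cV_setC A : g_sigma_preimage coor A -> g_sigma_preimage coor (~` A).
Proof. exact: sigma_algebraC. Qed.

Let cV_bigcup (F : _^nat) : (forall i, g_sigma_preimage coor (F i)) ->
  g_sigma_preimage coor (\bigcup_i (F i)).
Proof. exact: sigma_algebra_bigcup. Qed.

HB.instance Definition _ := @isMeasurable.Build default_measure_display
  'cV[R]_d (g_sigma_preimage coor) cV_set0 cV_setC cV_bigcup.

Lemma measurable_coor (i : 'I_d) :
  measurable_fun setT (fun x : 'cV[R]_d => x i 0 : measurableTypeR R).
Proof.
move=> _ Y mY; rewrite setTI; apply: sub_sigma_algebra => /=.
rewrite -bigcup_seq/=; exists i => /=; first by rewrite mem_index_enum.
by exists Y => //; rewrite setTI.
Qed.

Lemma measurable_fun_cV d' (T : measurableType d') (f : T -> 'cV[R]_d) :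
  (forall i, measurable_fun setT (fun x => f x i 0 : measurableTypeR R)) ->
  measurable_fun setT f.
Proof.
move=> mf; suff H : g_sigma_preimage (fun i => coor i \o f) `<=` measurable.
  move=> _ A mA; rewrite setTI; apply: H; rewrite g_sigma_preimage_comp.
  by exists A => //; rewrite setTI.
apply: smallest_sub; first exact: sigma_algebra_measurable.
move=> A; rewrite -bigcup_seq => -[i _ [B mB <-]]; exact: mf.
Qed.

End measurable_cV.

Definition cons_cV (R : realType) (d : nat)
  (p : measurableTypeR R * 'cV[R]_d) : 'cV[R]_d.+1 :=
  col_mx (p.1%:M : 'cV_1) p.2.

Lemma cons_cV0 (R : realType) d p : @cons_cV R d p 0 0 = p.1.
Proof.
rewrite /cons_cV (_ : 0 = lshift d (0 : 'I_1)); last exact/val_inj.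
by rewrite (@col_mxEu _ 1 d) mxE eqxx.
Qed.

Lemma cons_cVS (R : realType) d p (i : 'I_d) :
  @cons_cV R d p (lift 0 i) 0 = p.2 i 0.
Proof.
rewrite /cons_cV (_ : lift 0 i = rshift 1 i); last exact/val_inj.
by rewrite (@col_mxEd _ 1 d).
Qed.

Lemma measurable_cons_cV (R : realType) d : measurable_fun setT (@cons_cV R d).
Proof.
apply: measurable_fun_cV => i; have [j ->|->] := unliftP 0 i.
  rewrite (_ : (fun x => _) =
    (fun x : 'cV[R]_d => x j 0 : measurableTypeR R) \o snd).
    exact: measurableT_comp (@measurable_coor _ _ _) measurable_snd.
  by apply/funext => x; exact: cons_cVS.
rewrite (_ : (fun x => _) = fst); first exact: measurable_fst.
by apply/funext => x; exact: cons_cV0.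
Qed.

Section lebesgue_step.
Variables (R : realType) (d : nat)
  (mu : {sigma_finite_measure set 'cV[R]_d -> \bar R}).

Definition lebesgue_cons : set 'cV[R]_d.+1 -> \bar R :=
  pushforward (lebesgue_measure \x mu)%E (@cons_cV R d).

Let nu0 : lebesgue_cons set0 = 0%E.
Proof.
exact: (measure0 [the {measure set _ -> \bar R} of (lebesgue_measure \x mu)%E]).
Qed.

Let nu_ge0 A : (0 <= lebesgue_cons A)%E.
Proof. by apply: integral_ge0 => x _; exact: measure_ge0. Qed.

Let nu_sigma_additive : semi_sigma_additive lebesgue_cons.
Proof.
pose nu := [the {measure set _ -> \bar R} of (lebesgue_measure \x mu)%E].
move=> F mF tF mUF; rewrite /lebesgue_cons /pushforward preimage_bigcup.
have mc A : measurable A -> measurable (@cons_cV R d @^-1` A).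
  by move=> mA; rewrite -[X in measurable X]setTI; exact: measurable_cons_cV.
apply: (@measure_semi_sigma_additive _ _ _ nu).
- by move=> n; exact: mc.
- apply/trivIsetP => /= i j _ _ ij; rewrite -preimage_setI.
  by move/trivIsetP : tF => /(_ _ _ _ _ ij) ->//; rewrite preimage_set0.
- by rewrite -preimage_bigcup; exact: mc.
Qed.

HB.instance Definition _ := isMeasure.Build _ _ _ lebesgue_cons
  nu0 nu_ge0 nu_sigma_additive.

Let nu_sigma_finite : sigma_finite setT lebesgue_cons.
Proof.
have /sigma_finiteP[F [TF ndF Foo]] := sigma_finiteT (@lebesgue_measure R).
have /sigma_finiteP[G [TG ndG Goo]] := sigma_finiteT mu.
pose uncons (x : 'cV[R]_d.+1) : measurableTypeR R * 'cV[R]_d :=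
  (x 0 0, \col_i x (lift 0 i) 0).
have consK : cancel (@cons_cV R d) uncons.
  move=> p; rewrite /uncons cons_cV0 [p in RHS]surjective_pairing; congr pair.
  by apply/colP => i; rewrite mxE cons_cVS.
have unconsK : cancel uncons (@cons_cV R d).
  move=> x; apply/colP => i; have [j ->|->] := unliftP 0 i.
    by rewrite cons_cVS mxE.
  by rewrite cons_cV0.
have mu_uncons : measurable_fun setT uncons.
  apply/measurable_fun_pairP; split; first exact: measurable_coor.
  apply: measurable_fun_cV => i /=.
  rewrite [X in measurable_fun _ X](_ : _ = (fun x : 'cV[R]_d.+1 => x (lift 0 i) 0)).
    exact: measurable_coor.
  by apply/funext => x; rewrite mxE.
exists (fun n => uncons @^-1` (F n `*` G n)).
  rewrite -preimage_bigcup (_ : \bigcup_n _ = setT) ?preimage_setT//.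
  apply/seteqP; split=> // -[x y] _.
  have [n _ Fn] : (\bigcup_i F i) x by rewrite -TF.
  have [k _ Gk] : (\bigcup_i G i) y by rewrite -TG.
  exists (maxn n k) => //; split.
  - by move: x Fn; exact/subsetPset/ndF/leq_maxl.
  - by move: y Gk; exact/subsetPset/ndG/leq_maxr.
move=> n; have [mF Fn] := Foo n; have [mG Gn] := Goo n; split.
  by rewrite -[X in measurable X]setTI; apply: mu_uncons => //; exact: measurableX.
rewrite /lebesgue_cons /pushforward -comp_preimage.
rewrite (_ : uncons \o _ = id) ?preimage_id.
  by rewrite product_measure1E// lte_mul_pinfty// ge0_fin_numE.
by apply/funext => p /=; rewrite consK.
Qed.

HB.instance Definition _ :=
  Measure_isSigmaFinite.Build _ _ _ lebesgue_cons nu_sigma_finite.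

End lebesgue_step.

(* Iterated product of the Lebesgue measure on R, transported along
   R * R^d -> R^(d + 1); a Dirac mass on the one-point space R^0. *)
Fixpoint lebesgue_cV (R : realType) (d : nat) :
    {sigma_finite_measure set 'cV[R]_d -> \bar R} :=
  match d with
  | 0 => [the {sigma_finite_measure set _ -> \bar R} of \d_(0 : 'cV[R]_0)]
  | d'.+1 => [the {sigma_finite_measure set _ -> \bar R} of
      lebesgue_cons (lebesgue_cV R d')]
  end.

Section translation_invariance.
Variable R : realType.

Lemma measurable_shift_cV d (t : 'cV[R]_d) :
  measurable_fun setT (fun x : 'cV[R]_d => x + t).
Proof.
apply: measurable_fun_cV => i.
rewrite [X in measurable_fun _ X](_ : _ = (fun x : 'cV[R]_d => (x i 0 : R) + t i 0)).
  exact: measurable_funD (@measurable_coor _ _ _) _.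
by apply/funext => x; rewrite mxE.
Qed.

Lemma lebesgue_measure_shift (t : R) (A : set (measurableTypeR R)) :
  measurable A ->
  pushforward lebesgue_measure (fun x : R => x + t : measurableTypeR R) A =
  lebesgue_measure A.
Proof.
have mt : measurable_fun setT (fun x : R => x + t : measurableTypeR R).
  exact: measurable_funD.
move=> mA; apply/esym.
apply: (@lebesgue_measure_unique R
  [the measure _ _ of pushforward lebesgue_measure
    (fun x : R => x + t : measurableTypeR R)]) => //= _ [[a b]] _ <-.
rewrite /pushforward /=.
rewrite (_ : _ @^-1` _ = `]a - t, b - t]%classic); last first.
  by apply/seteqP; split => x /=; rewrite !in_itv/= ltrBlDr lerBrDr.
rewrite !lebesgue_measure_itv/= !lte_fin ltrD2r.
by case: ifPn => // _; congr EFin; rewrite opprB addrA subrK.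
Qed.

Lemma lebesgue_cV_shift d (t : 'cV[R]_d) (A : set 'cV[R]_d) :
  measurable A ->
  lebesgue_cV R d ((fun x => x + t) @^-1` A) = lebesgue_cV R d A.
Proof.
elim: d t A => [|d IH] t A mA.
  by congr (lebesgue_cV R 0 _); apply/seteqP; split => x /=;
    rewrite (_ : x + t = x)//; apply/colP => -[].
rewrite /= /lebesgue_cons /pushforward /product_measure1.
set B := @cons_cV R d @^-1` A.
have mB : measurable B.
  by rewrite -[B]setTI; exact: measurable_cons_cV.
pose phi (x : measurableTypeR R) := lebesgue_cV R d (xsection B x).
have mphi : measurable_fun setT phi by exact: measurable_fun_xsection.
pose t' : 'cV[R]_d := \col_i t (lift 0 i) 0.
transitivity (\int[@lebesgue_measure R]_x phi ((x : R) + t 0 0)%R)%E.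
  apply: eq_integral => x _.
  rewrite /= /phi -[RHS](IH t'); last exact: measurable_xsection.
  congr (lebesgue_cV R d _); apply/seteqP.
  have E y : cons_cV (x, y) + t = cons_cV (x + t 0 0, y + t').
    apply/colP => i; have [j ->|->] := unliftP 0 i.
      by rewrite [LHS]mxE !cons_cVS !mxE.
    by rewrite [LHS]mxE !cons_cV0.
  by split => y; rewrite /xsection/= !inE /B/= E.
pose sh : measurableTypeR R -> measurableTypeR R := fun x : R => x + t 0 0.
have mt : measurable_fun setT sh by exact: measurable_funD.
transitivity (\int[pushforward (@lebesgue_measure R)
    sh]_y phi y)%E.
  by rewrite ge0_integral_pushforward.
by apply: eq_measure_integral => //= E mE _; exact: lebesgue_measure_shift.
Qed.

End translation_invariance.

Section square_integrable.
Variables (R : realType) (d : nat).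
Local Notation C := R[i].
Local Notation Rd := 'cV[R]_d.
Local Notation mu := (lebesgue_cV R d).

Definition cmeasurable (f : Rd -> C) : Prop :=
  measurable_fun setT (fun x => complex.Re (f x)) /\
  measurable_fun setT (fun x => complex.Im (f x)).

Definition square_integrable (f : Rd -> C) : Prop :=
  cmeasurable f /\ (\int[mu]_x (Normc.normc (f x) ^+ 2)%:E < +oo)%E.

Definition sqint : {pred Rd -> C} := [pred f | `[< square_integrable f >]].

Lemma normc_sqr (z : C) :
  Normc.normc z ^+ 2 = complex.Re z ^+ 2 + complex.Im z ^+ 2.
Proof. by case: z => a b /=; rewrite sqr_sqrtr// addr_ge0// sqr_ge0. Qed.

Lemma measurable_normc_sqr (f : Rd -> C) : cmeasurable f ->
  measurable_fun setT (fun x => Normc.normc (f x) ^+ 2).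
Proof.
move=> [mr mi]; under eq_fun do rewrite normc_sqr.
by apply: measurable_funD; exact: measurable_funX.
Qed.

Lemma cmeasurableM (f g : Rd -> C) : cmeasurable f -> cmeasurable g ->
  cmeasurable (fun x => f x * g x).
Proof.
move=> [rf jf] [rg jg]; split.
  rewrite (_ : (fun x => _) = (fun x => complex.Re (f x) * complex.Re (g x) -
    complex.Im (f x) * complex.Im (g x))).
    by apply: measurable_funB; exact: measurable_funM.
  by apply/funext => x; case: (f x) (g x) => [? ?] [].
rewrite (_ : (fun x => _) = (fun x => complex.Re (f x) * complex.Im (g x) +
  complex.Im (f x) * complex.Re (g x))).
  by apply: measurable_funD; exact: measurable_funM.
by apply/funext => x; case: (f x) (g x) => [? ?] [].
Qed.

Lemma cmeasurableD (f g : Rd -> C) : cmeasurable f -> cmeasurable g ->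
  cmeasurable (fun x => f x + g x).
Proof.
move=> [rf jf] [rg jg]; split.
  rewrite (_ : (fun x => _) = (fun x => complex.Re (f x) + complex.Re (g x))).
    exact: measurable_funD.
  by apply/funext => x; case: (f x) (g x) => [? ?] [].
rewrite (_ : (fun x => _) = (fun x => complex.Im (f x) + complex.Im (g x))).
  exact: measurable_funD.
by apply/funext => x; case: (f x) (g x) => [? ?] [].
Qed.

Lemma sqint_submod_closed : submod_closed sqint.
Proof.
split.
  apply/asboolP; split; first by split; exact: measurable_cst.
  by rewrite integral0_eq// => x _; rewrite Normc.normc0 expr0n.
move=> a f g /asboolP[mf If] /asboolP[mg Ig]; apply/asboolP.
have maf : cmeasurable (fun x => a * f x).
  by apply: cmeasurableM => //; split; exact: measurable_cst.
have mafg : cmeasurable (a *: f + g) := cmeasurableD maf mg.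
split => //.
pose k : R := 2 * Normc.normc a ^+ 2.
have k0 : 0 <= k by rewrite mulr_ge0// sqr_ge0.
apply: (@le_lt_trans _ _
  (\int[mu]_x ((k * Normc.normc (f x) ^+ 2)%:E + (2 * Normc.normc (g x) ^+ 2)%:E))%E).
  apply: ge0_le_integral => //=.
  - by move=> x _; rewrite lee_fin sqr_ge0.
  - by apply/measurable_EFinP; exact: measurable_normc_sqr mafg.
  - apply/measurable_EFinP; apply: measurable_funD;
      by apply: measurable_funM => //; exact: measurable_normc_sqr.
  - move=> x _; rewrite lee_fin /k -mulrA -exprMn -Normc.normcM !normc_sqr.
    set z := a * f x.
    have -> : (a *: f + g) x = z + g x by [].
    case: z (g x) => [p q] [r s] /=.
    by have := sqr_ge0 (p - r); have := sqr_ge0 (q - s); nra.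
rewrite ge0_integralD//=; last 4 first.
- by move=> x _; rewrite lee_fin mulr_ge0// sqr_ge0.
- by apply/measurable_EFinP/measurable_funM => //; exact: measurable_normc_sqr.
- by move=> x _; rewrite lee_fin mulr_ge0// sqr_ge0.
- by apply/measurable_EFinP/measurable_funM => //; exact: measurable_normc_sqr.
under eq_integral do rewrite EFinM.
rewrite ge0_integralZl//; last 2 first.
- by apply/measurable_EFinP; exact: measurable_normc_sqr.
- by move=> x _; rewrite lee_fin sqr_ge0.
under [X in (_ + X)%E]eq_integral do rewrite EFinM.
rewrite ge0_integralZl//; last 2 first.
- by apply/measurable_EFinP; exact: measurable_normc_sqr.
- by move=> x _; rewrite lee_fin sqr_ge0.
by rewrite lte_add_pinfty// lte_mul_pinfty// lee_fin.
Qed.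

HB.instance Definition _ := GRing.isSubmodClosed.Build C (Rd -> C) sqint
  sqint_submod_closed.

Record L2fun := MkL2fun { L2fun_val :> Rd -> C ; _ : L2fun_val \in sqint }.
HB.instance Definition _ := [isSub for L2fun_val].
HB.instance Definition _ := [Choice of L2fun by <:].
HB.instance Definition _ := [SubChoice_isSubLmodule of L2fun by <:].

Lemma L2funP (f : L2fun) : square_integrable f.
Proof. by case: f => f /= /asboolP. Qed.

(* L2fun collects the square-integrable functions, and L2 below is its
   quotient by the subspace nullfun of almost everywhere null functions. *)
Definition nullfun : {pred L2fun} :=
  [pred f : L2fun | `[< \forall x \ae mu, f x = 0 >] ].

Lemma nullfunP (f : L2fun) : f \in nullfun <-> \forall x \ae mu, f x = 0.
Proof. by split => [/asboolP|h] //; apply/asboolP. Qed.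

Lemma nullfun_submod_closed : submod_closed nullfun.
Proof.
split; first by apply/nullfunP/aeW.
move=> a f g /nullfunP nf /nullfunP ng; apply/nullfunP.
apply: filterS2 nf ng => x fx gx.
by rewrite -[LHS]/(a * f x + g x) fx gx mulr0 addr0.
Qed.

HB.instance Definition _ := GRing.isSubmodClosed.Build C L2fun nullfun
  nullfun_submod_closed.

End square_integrable.

Section L2_space.
Local Open Scope quotient_scope.
Variables (R : realType) (d : nat).
Local Notation C := R[i].
Local Notation mu := (lebesgue_cV R d).

Definition L2 : Type := Quotient.quot (@nullfun R d).
HB.instance Definition _ := Choice.on L2.
HB.instance Definition _ := EqQuotient.on L2.
HB.instance Definition _ := GRing.Zmodule.on L2.

Lemma L2_eqP (f g : L2fun R d) :
  \pi_L2 f = \pi_L2 g <-> \forall x \ae mu, f x = g x.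
Proof.
have E : (f - g \in @nullfun R d) = (\pi_L2 f == \pi_L2 g).
  exact: (@Quotient.idealrBE (L2fun R d) (@nullfun R d) f g).
rewrite (rwP eqP) -E nullfunP; split; apply: filterS => x.
  by rewrite -[_ x]/(f x - g x) => /eqP; rewrite subr_eq0 => /eqP.
by move=> fg; rewrite -[LHS]/(f x - g x) fg subrr.
Qed.

Definition scaleL2 (a : C) : L2 -> L2 := lift_op1 L2 ( *:%R a).

Lemma pi_scaleL2 a (f : L2fun R d) : scaleL2 a (\pi_L2 f) = \pi_L2 (a *: f).
Proof.
unlock scaleL2; apply/L2_eqP.
have /L2_eqP : \pi_L2 (repr (\pi_L2 f)) = \pi_L2 f by rewrite reprK.
by apply: filterS => x h; congr (a * _).
Qed.

Lemma pi_addL2 (f g : L2fun R d) : \pi_L2 f + \pi_L2 g = \pi_L2 (f + g).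
Proof. exact/esym/Quotient.pi_add. Qed.

Let scaleA a b (f : L2) : scaleL2 a (scaleL2 b f) = scaleL2 (a * b) f.
Proof. by rewrite -[f]reprK !pi_scaleL2 scalerA. Qed.

Let scale1 : left_id 1 scaleL2.
Proof. by move=> f; rewrite -[f]reprK !pi_scaleL2 scale1r. Qed.

Let scaleDr : right_distributive scaleL2 +%R.
Proof.
by move=> a f g; rewrite -[f]reprK -[g]reprK !(pi_scaleL2, pi_addL2) scalerDr.
Qed.

Let scaleDl (f : L2) : {morph scaleL2^~ f : a b / a + b}.
Proof.
by move=> a b; rewrite /= -[f]reprK !(pi_scaleL2, pi_addL2) scalerDl.
Qed.

HB.instance Definition _ := GRing.Zmodule_isLmodule.Build C L2
  scaleA scale1 scaleDr scaleDl.

(* Linear in the first argument. The values of innerL2 and normL2 do not depend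
   on the representatives, cf. pi_innerL2 and pi_normL2. *)
Definition innerL2 (f g : L2) : C :=
  let h x := repr f x * (repr g x)^*%C in
  Complex (\int[mu]_x complex.Re (h x)) (\int[mu]_x complex.Im (h x)).

Definition normL2 (f : L2) : R :=
  Num.sqrt (\int[mu]_x (Normc.normc (repr f x) ^+ 2)).

Lemma pi_innerL2 (f g : L2fun R d) :
  innerL2 (\pi_L2 f) (\pi_L2 g) =
  Complex (\int[mu]_x complex.Re (f x * (g x)^*%C))
          (\int[mu]_x complex.Im (f x * (g x)^*%C)).
Proof.
have /L2_eqP hf : \pi_L2 (repr (\pi_L2 f)) = \pi_L2 f by rewrite reprK.
have /L2_eqP hg : \pi_L2 (repr (\pi_L2 g)) = \pi_L2 g by rewrite reprK.
have mM (a b : L2fun R d) : cmeasurable (fun x => a x * (b x)^*%C).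
  have [ma _] := L2funP a; have [[mr mi] _] := L2funP b.
  apply: cmeasurableM => //; split.
    by rewrite (_ : (fun x => _) = (fun x => complex.Re (b x)))//;
       apply/funext => x; case: (b x).
  rewrite (_ : (fun x => _) = (fun x => - complex.Im (b x))).
    exact: measurable_funN.
  by apply/funext => x; case: (b x).
have [m1 m2] := mM f g.
have [n1 n2] := mM (repr (\pi_L2 f)) (repr (\pi_L2 g)).
rewrite /innerL2; congr Complex; congr fine; apply: ae_eq_integral => //;
  try exact/measurable_EFinP.
- by apply: filterS2 hf hg => x -> ->.
- by apply: filterS2 hf hg => x -> ->.
Qed.

Lemma pi_normL2 (f : L2fun R d) :
  normL2 (\pi_L2 f) = Num.sqrt (\int[mu]_x (Normc.normc (f x) ^+ 2)).
Proof.
have /L2_eqP hf : \pi_L2 (repr (\pi_L2 f)) = \pi_L2 f by rewrite reprK.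
have [mf _] := L2funP f; have [mg _] := L2funP (repr (\pi_L2 f)).
congr Num.sqrt; congr fine; apply: ae_eq_integral => //.
- by apply/measurable_EFinP; exact: measurable_normc_sqr.
- by apply/measurable_EFinP; exact: measurable_normc_sqr.
- by apply: filterS hf => x ->.
Qed.

End L2_space.

Section time_frequency_shifts.
Local Open Scope quotient_scope.
Variables (R : realType) (d : nat).
Local Notation C := R[i].
Local Notation Rd := 'cV[R]_d.
Local Notation mu := (lebesgue_cV R d).

Definition dotR (w x : Rd) : R := \sum_(i < d) w i 0 * x i 0.

(* exp(i t) *)
Definition expi (t : R) : C := Complex (cos t) (sin t).

Lemma normc_expi t : Normc.normc (expi t) = 1.
Proof. by rewrite /= cos2Dsin2 sqrtr1. Qed.

Lemma modulation_subproof (w : Rd) (f : L2fun R d) :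
  (fun x => expi (2 * pi * dotR w x) * f x) \in @sqint R d.
Proof.
have [mf If] := L2funP f; apply/asboolP.
have md : measurable_fun setT (fun x : Rd => 2 * pi * dotR w x).
  apply: measurable_funM => //; apply: measurable_sum => i.
  by apply: measurable_funM => //; exact: measurable_coor.
split; last first.
  by under eq_integral do rewrite Normc.normcM normc_expi mul1r.
apply: cmeasurableM => //; split => /=.
  by apply: measurableT_comp md; apply: continuous_measurable_fun; exact: continuous_cos.
by apply: measurableT_comp md; apply: continuous_measurable_fun; exact: continuous_sin.
Qed.

Definition modulation_fun (w : Rd) (f : L2fun R d) : L2fun R d :=
  MkL2fun (modulation_subproof w f).

Lemma translation_subproof (t : Rd) (f : L2fun R d) :
  (fun x => f (x - t)) \in @sqint R d.
Proof.
have [mf If] := L2funP f; apply/asboolP.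
have ms := measurable_shift_cV (- t).
split.
  by case: mf => m1 m2; split; [exact: (measurableT_comp m1 ms)
                               |exact: (measurableT_comp m2 ms)].
apply: le_lt_trans If; rewrite le_eqVlt; apply/orP; left; apply/eqP.
pose F (x : Rd) := (Normc.normc (f x) ^+ 2)%:E.
transitivity (\int[pushforward mu (fun x : Rd => (x - t)%R)]_y F y)%E.
  rewrite ge0_integral_pushforward//.
    by apply/measurable_EFinP; exact: measurable_normc_sqr.
  by move=> x _; rewrite lee_fin sqr_ge0.
by apply: eq_measure_integral => //= A mA _; exact: lebesgue_cV_shift.
Qed.

Definition translation_fun (t : Rd) (f : L2fun R d) : L2fun R d :=
  MkL2fun (translation_subproof t f).

(* modulation and translation are lifted to classes through representatives;
   pi_modulation and pi_translation show that they do not depend on the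
   choice. *)
Definition modulation (w : Rd) : L2 R d -> L2 R d :=
  lift_op1 (L2 R d) (modulation_fun w).

Definition translation (t : Rd) : L2 R d -> L2 R d :=
  lift_op1 (L2 R d) (translation_fun t).

Lemma pi_modulation w (f : L2fun R d) :
  modulation w (\pi_(L2 R d) f) = \pi_(L2 R d) (modulation_fun w f).
Proof.
unlock modulation; apply/L2_eqP.
have /L2_eqP : \pi_(L2 R d) (repr (\pi_(L2 R d) f)) = \pi_(L2 R d) f by rewrite reprK.
by apply: filterS => x /= ->.
Qed.

Lemma ae_shift t (P : set Rd) :
  (\forall x \ae mu, P x) -> \forall x \ae mu, P (x - t).
Proof.
move=> [A [mA A0 PA]]; exists ((fun x => x - t) @^-1` A); split.
- by rewrite -[X in measurable X]setTI; exact: measurable_shift_cV.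
- by have := lebesgue_cV_shift (- t) mA; rewrite A0.
- by move=> x /= nP; apply: PA.
Qed.

Lemma pi_translation t (f : L2fun R d) :
  translation t (\pi_(L2 R d) f) = \pi_(L2 R d) (translation_fun t f).
Proof.
unlock translation; apply/L2_eqP.
have /L2_eqP : \pi_(L2 R d) (repr (\pi_(L2 R d) f)) = \pi_(L2 R d) f by rewrite reprK.
exact: ae_shift.
Qed.

(* For l = (w, t), the operator E_w T_t. *)
Definition tfshift (l : 'cV[R]_(d + d)) (f : L2 R d) : L2 R d :=
  modulation (usubmx l) (translation (dsubmx l) f).

End time_frequency_shifts.

Section frames.
Variables (R : realType) (d : nat).
Local Notation C := R[i].
Local Notation L2 := (L2 R d).

Definition bounded_operator (V : L2 -> L2) : Prop :=
  exists M : R, forall f, normL2 (V f) <= M * normL2 f.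

Definition is_frame (I : choiceType) (e : I -> L2) : Prop :=
  exists A B : R, [/\ 0 < A, A <= B & forall f : L2,
    ((A * normL2 f ^+ 2)%:E <=
       \esum_(i in [set: I]) (Normc.normc (innerL2 f (e i)) ^+ 2)%:E <=
     (B * normL2 f ^+ 2)%:E)%E].

(* Unconditional convergence: the partial sums over the finite subsets of I,
   directed by inclusion, tend to s in norm. *)
Definition has_sum (I : choiceType) (e : I -> L2) (s : L2) : Prop :=
  normL2 (s - partial_sum e F) @[F --> totally] --> (0 : R).

(* M = M_(m, Psi, Phi), i.e. M f = sum_i m_i <f, Phi_i> Psi_i. *)
Definition is_multiplier (I : choiceType) (m : I -> C) (Psi Phi : I -> L2)
    (M : L2 -> L2) : Prop :=
  forall f : L2, has_sum (fun i => (m i * innerL2 f (Phi i)) *: Psi i) (M f).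

Definition is_lattice (n : nat) (Lam : set 'cV[R]_n) : Prop :=
  exists2 A : 'M[R]_n, A \in unitmx &
    Lam = [set A *m map_mx intr z | z in [set: 'cV[int]_n]].

(* The family is indexed by the subtype of the points of Lam. *)
Definition gabor_system (Lam : set 'cV[R]_(d + d)) (u : L2) : Lam -> L2 :=
  fun l => tfshift (val l) u.

Definition is_gabor_frame (Lam : set 'cV[R]_(d + d)) (u : L2) : Prop :=
  is_frame (@gabor_system Lam u).

Definition is_gabor_frame_multiplier1 (Lam : set 'cV[R]_(d + d))
    (M : L2 -> L2) : Prop :=
  exists u v : L2, [/\ is_gabor_frame Lam u, is_gabor_frame Lam v &
    is_multiplier (fun=> 1) (@gabor_system Lam v) (@gabor_system Lam u) M].

End frames.

(* Main.v *)
(* Let S h = sum_l <h, pi(l) g> pi(l) g be the frame operator of g. It is bounded,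
   self-adjoint and bounded below, hence onto, and it commutes with every pi(l)
   because pi(m) only permutes the pi(l) g up to phases, which cancel. With
   S u = g this gives f = sum_l <f, pi(l) u> pi(l) g for all f, where u generates
   a Gabor frame. If V pi(l) g = pi(l) V g, applying V to this expansion shows
   that V is the multiplier with windows u and V g; any multiplier with constant
   symbol commutes with the pi(l). That V g generates a Gabor frame uses only the
   surjectivity of V, through the uniform boundedness principle, so neither
   adjoints nor the boundedness of the inverse of V are needed. Finally V^-1 maps
   the frame expansion along the pi(l) V g to a series along the pi(l) g, which
   makes V^-1 a multiplier too. *)

Require Import Defs.
From HB Require Import structures.
From mathcomp Require Import all_boot all_order all_algebra.
From mathcomp Require Import generic_quotient.
From mathcomp Require Import all_classical all_reals all_analysis.
From mathcomp Require Import finmap measurable_realfun summability.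
From mathcomp Require Import complex ring lra.

Set Implicit Arguments.
Unset Strict Implicit.
Unset Printing Implicit Defensive.
Import Order.TTheory GRing.Theory Num.Theory.
Import numFieldNormedType.Exports.

Local Open Scope classical_set_scope.
Local Open Scope ring_scope.

(** * The inner product and the norm on classes of functions *)

Section inner_product.
Local Open Scope quotient_scope.
Variables (R : realType) (d : nat).
Local Notation C := R[i].
Local Notation L2 := (L2 R d).
Local Notation mu := (lebesgue_cV R d).
Implicit Types f g h : L2.

Lemma cmeasurable_conj (a : 'cV[R]_d -> C) :
  cmeasurable a -> cmeasurable (fun x => (a x)^*%C).
Proof.
move=> [mr mi]; split.
  by rewrite (_ : (fun x => _) = (fun x => complex.Re (a x)))//;
    apply/funext => x; case: (a x).
rewrite (_ : (fun x => _) = (fun x => - complex.Im (a x))).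
  exact: measurable_funN.
by apply/funext => x; case: (a x).
Qed.

Lemma integrable_normc_sqr (a : L2fun R d) :
  mu.-integrable setT (EFin \o (fun x => Normc.normc (a x) ^+ 2)).
Proof.
have [ma ia] := L2funP a; apply/integrableP; split.
  by apply/measurable_EFinP; exact: measurable_normc_sqr.
by under eq_integral do rewrite /= ger0_norm ?sqr_ge0//.
Qed.

(** Both parts of the product are dominated by the integrable function |a|^2 + |b|^2. *)
Lemma integrable_conjM (a b : L2fun R d) :
  mu.-integrable setT (EFin \o (fun x => complex.Re (a x * (b x)^*%C))) /\
  mu.-integrable setT (EFin \o (fun x => complex.Im (a x * (b x)^*%C))).
Proof.
have [ma _] := L2funP a; have [mb _] := L2funP b.
have [mr mi] := cmeasurableM ma (cmeasurable_conj mb).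
have ig : mu.-integrable setT (EFin \o (fun x =>
    Normc.normc (a x) ^+ 2 + Normc.normc (b x) ^+ 2)).
  by apply: (integrableD measurableT (integrable_normc_sqr a) (integrable_normc_sqr b)).
split; apply: le_integrable ig => //; try exact/measurable_EFinP.
  move=> x _; rewrite /= lee_fin [leRHS]ger0_norm ?addr_ge0 ?sqr_ge0// !normc_sqr ler_norml.
  case: (a x) (b x) => [p q] [r s] /=; apply/andP; split.
    by have := sqr_ge0 (p + r); have := sqr_ge0 (q + s);
      have := sqr_ge0 p; have := sqr_ge0 q; have := sqr_ge0 r;
      have := sqr_ge0 s; nra.
  by have := sqr_ge0 (p - r); have := sqr_ge0 (q - s);
      have := sqr_ge0 p; have := sqr_ge0 q; have := sqr_ge0 r;
      have := sqr_ge0 s; nra.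
move=> x _; rewrite /= lee_fin [leRHS]ger0_norm ?addr_ge0 ?sqr_ge0// !normc_sqr ler_norml.
case: (a x) (b x) => [p q] [r s] /=; apply/andP; split.
  by have := sqr_ge0 (q + r); have := sqr_ge0 (p - s);
      have := sqr_ge0 p; have := sqr_ge0 q; have := sqr_ge0 r;
      have := sqr_ge0 s; nra.
by have := sqr_ge0 (q - r); have := sqr_ge0 (p + s);
      have := sqr_ge0 p; have := sqr_ge0 q; have := sqr_ge0 r;
      have := sqr_ge0 s; nra.
Qed.

Lemma pi_scalerL2 (z : C) (a : L2fun R d) : z *: \pi_L2 a = \pi_L2 (z *: a).
Proof. exact: pi_scaleL2. Qed.

Lemma pi_subL2 (a b : L2fun R d) : \pi_L2 (a - b) = \pi_L2 a - \pi_L2 b.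
Proof.
by rewrite -(scaleN1r b) -(scaleN1r (\pi_L2 b)) -pi_addL2 pi_scalerL2.
Qed.

Lemma innerL2DZl (z : C) f g h :
  innerL2 (z *: f + g) h = z * innerL2 f h + innerL2 g h.
Proof.
rewrite -[f]reprK -[g]reprK -[h]reprK.
move: (repr f) (repr g) (repr h) => a b c.
rewrite pi_scalerL2 pi_addL2 !pi_innerL2; case: z => p q.
have [ra ia] := integrable_conjM a c; have [rb ib] := integrable_conjM b c.
have iZ r (u : 'cV[R]_d -> R) : mu.-integrable setT (EFin \o u) ->
    mu.-integrable setT (EFin \o (fun x => r * u x)).
  by move=> iu; exact: (integrableZl measurableT r iu).
have iD (u v : 'cV[R]_d -> R) : mu.-integrable setT (EFin \o u) ->
    mu.-integrable setT (EFin \o v) ->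
    mu.-integrable setT (EFin \o (fun x => u x + v x)).
  by move=> iu iv; exact: (integrableD measurableT iu iv).
have iB (u v : 'cV[R]_d -> R) : mu.-integrable setT (EFin \o u) ->
    mu.-integrable setT (EFin \o v) ->
    mu.-integrable setT (EFin \o (fun x => u x - v x)).
  by move=> iu iv; exact: (integrableB measurableT iu iv).
have E x : (Complex p q *: a + b : L2fun R d) x = Complex p q * a x + b x by [].
have cMD (r s r' s' : R) : Complex p q * Complex r s + Complex r' s' =
  Complex (p * r - q * s + r') (p * s + q * r + s') by [].
rewrite cMD -!RintegralZl// -RintegralB//; try exact: iZ.
rewrite -!RintegralD//; try by [exact: iZ|apply: iB; exact: iZ|apply: iD; exact: iZ].
congr Complex; apply: eq_Rintegral => x _; rewrite E;
  case: (a x) (b x) (c x) => [? ?] [? ?] [? ?] /=; ring.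
Qed.

Lemma innerL2_conj f g : innerL2 g f = (innerL2 f g)^*%C.
Proof.
rewrite -[f]reprK -[g]reprK; move: (repr f) (repr g) => a b.
rewrite !pi_innerL2 /=; congr Complex.
  by apply: eq_Rintegral => x _; case: (a x) (b x) => [? ?] [? ?] /=; ring.
have [_ ib] := integrable_conjM a b.
rewrite -mulN1r -RintegralZl//.
by apply: eq_Rintegral => x _; case: (a x) (b x) => [? ?] [? ?] /=; ring.
Qed.

Lemma normL2_ge0 f : 0 <= normL2 f. Proof. exact: sqrtr_ge0. Qed.

Lemma normL2_sqr (a : L2fun R d) :
  normL2 (\pi_L2 a) ^+ 2 = \int[mu]_x (Normc.normc (a x) ^+ 2).
Proof.
by rewrite pi_normL2 sqr_sqrtr// Rintegral_ge0// => x _; rewrite sqr_ge0.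
Qed.

Lemma innerL2_self f : innerL2 f f = (normL2 f ^+ 2)%:C%C.
Proof.
rewrite -[f]reprK; move: (repr f) => a; rewrite normL2_sqr pi_innerL2.
congr Complex.
  by apply: eq_Rintegral => x _; rewrite normc_sqr; case: (a x) => ? ? /=; ring.
transitivity (0 * fine (mu setT)); last by rewrite mul0r.
by rewrite -Rintegral_cst//; apply: eq_Rintegral => x _; case: (a x) => ? ? /=; ring.
Qed.

Lemma normL2_eq0 f : normL2 f = 0 -> f = 0.
Proof.
rewrite -[f]reprK; move: (repr f) => a a0.
have : normL2 (\pi_L2 a) ^+ 2 = 0 by rewrite a0 expr0n.
rewrite normL2_sqr => i0.
(* A real integral is the [fine] part of the extended one, and [fine] also sends infinity to 0;
   square-integrability excludes that case. *)
have {}i0 : (\int[mu]_x (Normc.normc (a x) ^+ 2)%:E = 0)%E.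
  rewrite -[LHS]fineK; first by congr EFin.
  by apply: integrable_fin_num => //; exact: integrable_normc_sqr.
have -> : 0 = \pi_L2 (0 *: a) by rewrite -pi_scalerL2 scale0r.
apply/L2_eqP.
have [ma _] := L2funP a.
have ma2 : measurable_fun setT (fun x => (Normc.normc (a x) ^+ 2)%:E).
  by apply/measurable_EFinP; exact: measurable_normc_sqr.
have a2 : (\int[mu]_x `|(Normc.normc (a x) ^+ 2)%:E| = 0)%E.
  by rewrite -i0; apply: eq_integral => x _; rewrite gee0_abs// lee_fin sqr_ge0.
have [/(_ a2) + _] := ae_eq_integral_abs mu measurableT ma2.
apply: filterS => x /(_ I) [] /eqP; rewrite sqrf_eq0 => /eqP /Normc.eq0_normc ->.
by rewrite -[RHS]/(0 * a x) mul0r.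
Qed.

End inner_product.

(** * Completeness of [L2] (Riesz-Fischer) *)

Section completeness.
Local Open Scope quotient_scope.
Variables (R : realType) (d : nat).
Local Notation C := R[i].
Local Notation Rd := 'cV[R]_d.
Local Notation L2 := (L2 R d).
Local Notation mu := (lebesgue_cV R d).

(** The hypothesis bounds each increment by sqrt K / 2^n, so the telescoping series converges
    absolutely. *)
Lemma cvgn_geometric_step (v : R^nat) (K : R) :
  (forall n, (2 ^+ n * (v n.+1 - v n)) ^+ 2 <= K) -> cvgn v.
Proof.
move=> vK.
have step n : `|v n.+1 - v n| <= geometric (Num.sqrt K) 2^-1 n.
  have p0 : 0 < (2 : R) ^+ n by rewrite exprn_gt0.
  rewrite /= exprVn ler_pdivlMr// mulrC -[X in X * _](gtr0_norm p0) -normrM.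
  by rewrite -sqrtr_sqr ler_wsqrtr.
have cs : cvgn [normed series (telescope v)].
  apply: (series_le_cvg _ _ step) => //.
  - by move=> n; rewrite /= mulr_ge0 ?sqrtr_ge0// exprn_ge0// invr_ge0.
  - by apply: is_cvg_geometric_series; rewrite gtr0_norm ?invr_gt0// invf_lt1// ltr1n.
have {cs} cs := normed_cvg cs.
rewrite (_ : v = cst (v 0) + series (telescope v)); last first.
  by apply/funext => n; exact: eq_sum_telescope.
by apply: is_cvgD => //; exact: is_cvg_cst.
Qed.

Lemma normL2_pi_le (a : L2fun R d) (e : R) : 0 <= e ->
  (normL2 (\pi_L2 a) <= e) =
  (\int[mu]_x (Normc.normc (a x) ^+ 2)%:E <= (e ^+ 2)%:E)%E.
Proof.
move=> e0; rewrite -(@fineK _ (\int[mu]_x _)%E); last first.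
  by apply: integrable_fin_num => //; exact: integrable_normc_sqr.
by rewrite lee_fin -[fine _](normL2_sqr a) ler_pXn2r// ?nnegrE ?normL2_ge0.
Qed.

(** Fatou's lemma applied to |a_n - b|^2. The bound it gives also shows that s - b, hence s, is
    square-integrable. *)
Lemma sqint_cvg_le (a : nat -> L2fun R d) (s : Rd -> C) (b : L2fun R d) (e : R) :
  0 <= e ->
  (forall x, complex.Re (a n x) @[n --> \oo] --> complex.Re (s x)) ->
  (forall x, complex.Im (a n x) @[n --> \oo] --> complex.Im (s x)) ->
  (\forall m \near \oo, normL2 (\pi_L2 (a m - b)) <= e) ->
  exists2 c : L2fun R d, c =1 s & normL2 (\pi_L2 (c - b)) <= e.
Proof.
move=> e0 sr si abe.
have ms : cmeasurable s.
  split; [apply: (measurable_fun_cvg (h := fun n x => complex.Re (a n x))) => // n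
         |apply: (measurable_fun_cvg (h := fun n x => complex.Im (a n x))) => // n].
  - by have [[]] := L2funP (a n).
  - by have [[]] := L2funP (a n).
have msb : cmeasurable (fun x => s x - b x).
  have [mb _] := L2funP b.
  rewrite [X in cmeasurable X](_ : _ = (fun x => s x + (-1) * b x)); last first.
    by apply/funext => x; rewrite mulN1r.
  have m1 : @cmeasurable R d (fun=> -1) by split; exact: measurable_cst.
  exact: (cmeasurableD ms (cmeasurableM m1 mb)).
have le : (\int[mu]_x (Normc.normc (s x - b x) ^+ 2)%:E <= (e ^+ 2)%:E)%E.
  pose f n x := (Normc.normc ((a n - b : L2fun R d) x) ^+ 2)%:E.
  have fE x : limn_einf (f ^~ x) = (Normc.normc (s x - b x) ^+ 2)%:E.
    suff h : f n x @[n --> \oo] --> (Normc.normc (s x - b x) ^+ 2)%:E.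
      by have [-> _] := cvg_limn_einf_sup h.
    apply/cvg_EFin; first exact: nearW.
    have E n : fine (f n x) = (complex.Re (a n x) - complex.Re (b x)) ^+ 2 +
        (complex.Im (a n x) - complex.Im (b x)) ^+ 2.
      rewrite -[fine _]/(Normc.normc (a n x - b x) ^+ 2) normc_sqr.
      by case: (a n x) (b x) => [? ?] [? ?].
    rewrite (_ : fine \o _ = fun n => (complex.Re (a n x) - complex.Re (b x)) ^+ 2 +
        (complex.Im (a n x) - complex.Im (b x)) ^+ 2); last exact/funext.
    rewrite (_ : Normc.normc _ ^+ 2 = (complex.Re (s x) - complex.Re (b x)) ^+ 2 +
        (complex.Im (s x) - complex.Im (b x)) ^+ 2); last first.
      by rewrite normc_sqr; case: (s x) (b x) => [? ?] [? ?].
    by apply: cvgD; rewrite expr2; under eq_cvg do rewrite expr2;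
      apply: cvgM; apply: cvgB => //; exact: cvg_cst.
  under eq_integral do rewrite -fE.
  apply: le_trans (fatou _ _ _ _) _ => //.
  - move=> n; apply/measurable_EFinP; apply: measurable_normc_sqr.
    by have [] := L2funP (a n - b).
  - by move=> n x _; rewrite lee_fin sqr_ge0.
  rewrite limn_einf_lim; apply: lime_le.
    exact: is_cvg_einfs.
  (* The infimum over the tail from n is at most the term of index max n N, where the bound [e]
     already holds. *)
  case: abe => N _ abe; apply: nearW => n.
  apply: ereal_inf_le; exists (\int[mu]_x f (maxn n N) x)%E.
    by exists (maxn n N) => //=; exact: leq_maxl.
  by rewrite -normL2_pi_le//; apply: abe => /=; exact: leq_maxr.
have sb : (fun x => s x - b x) \in @sqint R d.
  by apply/asboolP; split => //; apply: le_lt_trans le _; exact: ltry.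
exists (MkL2fun sb + b) => [x|].
  by rewrite -[LHS]/(s x - b x + b x) subrK.
by rewrite addrK normL2_pi_le.
Qed.

Lemma cmeasurable_indic (E : set Rd) : measurable E ->
  cmeasurable (fun x => (\1_E x)%:C%C : C).
Proof.
by move=> mE; split; [exact: (measurable_indic mE)|exact: measurable_cst].
Qed.

Lemma cutoff_subproof (E : set Rd) (mE : measurable E) (a : L2fun R d) :
  (fun x => (\1_E x)%:C%C * a x) \in @sqint R d.
Proof.
have [ma ia] := L2funP a; apply/asboolP; split.
  by apply: cmeasurableM => //; exact: cmeasurable_indic.
apply: le_lt_trans ia; apply: ge0_le_integral => //.
- by move=> x _; rewrite lee_fin sqr_ge0.
- apply/measurable_EFinP; apply: measurable_normc_sqr.
  exact: (cmeasurableM (cmeasurable_indic mE) ma).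
- by apply/measurable_EFinP; exact: measurable_normc_sqr.
- move=> x _; rewrite lee_fin Normc.normcM exprMn indicE.
  by case: (x \in E); rewrite /= ?expr1n ?expr0n/= ?addr0 ?sqrtr1 ?sqrtr0 ?expr1n
    ?expr0n/= ?mul1r// mul0r sqr_ge0.
Qed.

(* The weighted sum [H] of the squared increments has finite integral, hence is
   finite almost everywhere; where it is, the increments decrease geometrically.
   The other points are cut off. *)
Lemma L2_repr_cvg (u : nat -> L2) :
  (forall n, normL2 (u n.+1 - u n) ^+ 2 <= 8^-1 ^+ n) ->
  exists a : nat -> L2fun R d, [/\ forall n, \pi_L2 (a n) = u n,
    forall x, cvgn (fun n => complex.Re (a n x)) &
    forall x, cvgn (fun n => complex.Im (a n x))].
Proof.
move=> u8; pose b n := repr (u n).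
pose D n x := ((2 ^+ n * Normc.normc ((b n.+1 - b n : L2fun R d) x)) ^+ 2)%:E.
have DE n x : D n x = (((2 ^+ n) ^+ 2)%:E *
    (Normc.normc ((b n.+1 - b n : L2fun R d) x) ^+ 2)%:E)%E.
  by rewrite -EFinM -exprMn.
have mb n : measurable_fun setT
    (fun x => (Normc.normc ((b n.+1 - b n : L2fun R d) x) ^+ 2)%:E).
  apply/measurable_EFinP; apply: measurable_normc_sqr.
  by have [] := L2funP (b n.+1 - b n).
have mD n : measurable_fun setT (D n).
  have -> : D n = _ := funext (DE n).
  by apply: emeasurable_funM => //; exact: measurable_cst.
have D0 n x : (0 <= D n x)%E by rewrite lee_fin sqr_ge0.
pose H x := (\sum_(n <oo) D n x)%E.
have mH : measurable_fun setT H by exact: ge0_emeasurable_sum.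
have H0 x : (0 <= H x)%E by exact: nneseries_ge0.
have iH : (\int[mu]_x H x < +oo)%E.
  rewrite integral_nneseries//.
  (* The integral of [D n] is at most 4^n 8^-n = 2^-n, written 2 / 2^(n+1) to match the summation
     formula of the geometric series. *)
  apply: (@le_lt_trans _ _ (\sum_(n <oo) (2 / (2 ^ (n + 1))%:R)%:E)%E); last first.
    have /cvg_lim E := @cvg_geometric_eseries_half R 2 0.
    by rewrite [ltLHS]E// ltry.
  apply: lee_nneseries => [n *|n *]; first by apply: integral_ge0 => x _.
  under eq_integral do rewrite DE.
  rewrite ge0_integralZl ?lee_fin ?sqr_ge0//; last first.
    by move=> x _; rewrite lee_fin sqr_ge0.
  apply: (@le_trans _ _ (((2 ^+ n) ^+ 2)%:E * (8^-1 ^+ n)%:E)%E).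
    apply: lee_wpmul2l; first by rewrite lee_fin sqr_ge0.
    rewrite -(@sqr_sqrtr _ (8^-1 ^+ n)) ?exprn_ge0 ?invr_ge0//.
    rewrite -normL2_pi_le ?sqrtr_ge0//.
    have -> : \pi_L2 (b n.+1 - b n) = u n.+1 - u n.
      rewrite -[u n.+1]reprK -[u n]reprK -/(b n) -/(b n.+1).
      exact: pi_subL2.
    by rewrite -[leLHS]ger0_norm ?normL2_ge0// -sqrtr_sqr ler_wsqrtr.
  rewrite -EFinM lee_fin -exprM mulnC exprM -exprMn.
  have -> : 2 ^+ 2 * 8^-1 = 2^-1 :> R by lra.
  by rewrite addn1 natrX exprS invfM mulrA divff// mul1r exprVn.
pose E := [set x | H x \is a fin_num].
have mE : measurable E by rewrite -[E]setTI; exact: emeasurable_fin_num.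
have aeE : \forall x \ae mu, E x.
  have iHH : mu.-integrable setT H.
    apply/integrableP; split => //.
    by under eq_integral do rewrite gee0_abs//.
  by apply: filterS (integrable_ae measurableT iHH) => x /(_ I).
have bound x : E x -> forall n, (2 ^+ n * Normc.normc (b n.+1 x - b n x)) ^+ 2 <= fine (H x).
  move=> Ex n; rewrite -lee_fin fineK//.
  rewrite -[leLHS]/(D n x).
  apply: le_trans (@nneseries_lim_ge _ (fun n => D n x) xpredT 0 n.+1 _) => //.
  by rewrite big_nat_recr//= leeDr// sume_ge0.
exists (fun n => MkL2fun (cutoff_subproof mE (b n))); split.
- move=> n; rewrite -[u n]reprK; apply/L2_eqP.
  apply: filterS aeE => x Ex.
  by rewrite /= indicE mem_set// mul1r.
- move=> x; have [Ex|nEx] := pselect (E x); last first.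
    rewrite /= indicE memNset//=.
    under eq_fun do rewrite mul0r; exact: is_cvg_cst.
  rewrite /= indicE mem_set//=.
  under eq_fun do rewrite mul1r.
  apply: (@cvgn_geometric_step _ (fine (H x))) => n.
  apply: le_trans (bound _ Ex n).
  rewrite !exprMn ler_pM2l ?exprn_gt0// normc_sqr.
  by case: (b n.+1 x) (b n x) => [? ?] [? ?] /=; rewrite lerDl sqr_ge0.
- move=> x; have [Ex|nEx] := pselect (E x); last first.
    rewrite /= indicE memNset//=.
    under eq_fun do rewrite mul0r; exact: is_cvg_cst.
  rewrite /= indicE mem_set//=.
  under eq_fun do rewrite mul1r.
  apply: (@cvgn_geometric_step _ (fine (H x))) => n.
  apply: le_trans (bound _ Ex n).
  rewrite !exprMn ler_pM2l ?exprn_gt0// normc_sqr.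
  by case: (b n.+1 x) (b n x) => [? ?] [? ?] /=; rewrite lerDr sqr_ge0.
Qed.

(** A subsequence with increments at most 8^(-n/2) has representatives that converge pointwise;
    Fatou's lemma then carries the Cauchy bounds of the whole sequence over to the limit. *)
Theorem L2_complete (w : nat -> L2) :
  (forall e : R, 0 < e -> exists N, forall m n, (N <= m)%N -> (N <= n)%N ->
    normL2 (w m - w n) <= e) ->
  exists s, forall e : R, 0 < e -> exists N, forall n, (N <= n)%N ->
    normL2 (s - w n) <= e.
Proof.
move=> cw; pose r n : R := Num.sqrt (8^-1 ^+ n).
have r0 n : 0 < r n by rewrite sqrtr_gt0 exprn_gt0// invr_gt0.
have [N NP] := choice (fun n => cw _ (r0 n)).
(* Partial sums of the thresholds give a nondecreasing [phi] that dominates both [N n] and n. *)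
pose phi n := (\sum_(0 <= i < n.+1) (N i).+1)%N.
have Nphi n : (N n <= phi n)%N.
  by rewrite /phi big_nat_recr//= (leq_trans (leqnSn _))// leq_addl.
have phiS n : (phi n <= phi n.+1)%N by rewrite /phi [leqRHS]big_nat_recr//= leq_addr.
have le_phi n : (n <= phi n)%N.
  elim: n => // n IH; rewrite /phi big_nat_recr//= addnS ltnS.
  exact: leq_trans IH (leq_addr _ _).
have uw n : normL2 (w (phi n.+1) - w (phi n)) ^+ 2 <= 8^-1 ^+ n.
  rewrite -(@sqr_sqrtr _ (8^-1 ^+ n)) ?exprn_ge0 ?invr_ge0//.
  rewrite ler_pXn2r ?nnegrE ?sqrtr_ge0//.
  by apply: NP => //; exact: leq_trans (Nphi n) (phiS n).
have [a [au cr ci]] := @L2_repr_cvg (w \o phi) uw.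
pose s x := Complex (limn (fun n => complex.Re (a n x)))
                    (limn (fun n => complex.Im (a n x))).
have key e : 0 < e -> exists N, forall n, (N <= n)%N ->
    exists2 c : L2fun R d, c =1 s & normL2 (\pi_L2 c - w n) <= e.
  move=> e0; have [M MP] := cw _ e0; exists M => n Mn.
  have [|||c cs ce] := @sqint_cvg_le a s (repr (w n)) e (ltW e0) => //.
    exists M => // m /= Mm; rewrite pi_subL2 reprK au /=; apply: MP => //.
    exact: leq_trans Mm (le_phi m).
  by exists c => //; rewrite pi_subL2 reprK in ce.
(* The limit is fixed once as the class of [c0]; the functions [c] obtained for other bounds agree
   with it pointwise. *)
have [M /(_ M (leqnn M))[c0 c0s _]] := key 1 ltr01.
exists (\pi_L2 c0) => e /key[K KP]; exists K => n /KP[c cs].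
rewrite (_ : \pi_L2 c0 = \pi_L2 c)//.
by apply/L2_eqP/aeW => x; rewrite cs c0s.
Qed.

End completeness.

(** * Hilbert space geometry: Cauchy-Schwarz and the triangle inequality *)

Section hilbert_geometry.
Variables (R : realType) (d : nat).
Local Notation C := R[i].
Local Notation L2 := (L2 R d).
Local Notation normc := Normc.normc.
Implicit Types (f g h : L2) (z : C).

Lemma normc_ge0 z : 0 <= normc z.
Proof. by case: z => a b; exact: sqrtr_ge0. Qed.

Lemma normc_conj z : normc z^*%C = normc z.
Proof. by case: z => a b /=; rewrite sqrrN. Qed.

Lemma normcC (r : R) : normc r%:C%C = `|r|.
Proof. by rewrite /= expr0n/= addr0 sqrtr_sqr. Qed.

Lemma normRe_le_normc z : `|complex.Re z| <= normc z.
Proof.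
by case: z => a b /=; rewrite -sqrtr_sqr ler_wsqrtr// lerDl sqr_ge0.
Qed.

Lemma Re_le_normc z : complex.Re z <= normc z.
Proof. exact: le_trans (ler_norm _) (normRe_le_normc z). Qed.

Lemma mul_conjc z : z * z^*%C = (normc z ^+ 2)%:C%C.
Proof.
rewrite normc_sqr; case: z => a b; apply/eqP; rewrite eq_complex /=.
by apply/andP; split; apply/eqP; ring.
Qed.

Lemma normcB_sym (a b : C) : normc (a - b) = normc (b - a).
Proof. by rewrite -opprB normcN. Qed.

Lemma innerL2Dl f g h : innerL2 (f + g) h = innerL2 f h + innerL2 g h.
Proof. by rewrite -[f in LHS]scale1r innerL2DZl mul1r. Qed.

Lemma innerL20l h : innerL2 0 h = 0.
Proof. by apply: (addIr (innerL2 0 h)); rewrite -innerL2Dl addr0 add0r. Qed.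

Lemma innerL2Zl z f h : innerL2 (z *: f) h = z * innerL2 f h.
Proof. by rewrite -[z *: f]addr0 innerL2DZl innerL20l addr0. Qed.

Lemma innerL2Bl f g h : innerL2 (f - g) h = innerL2 f h - innerL2 g h.
Proof. by rewrite innerL2Dl -scaleN1r innerL2Zl mulN1r. Qed.

Lemma innerL2Dr f g h : innerL2 h (f + g) = innerL2 h f + innerL2 h g.
Proof. by rewrite innerL2_conj innerL2Dl (innerL2_conj f h) (innerL2_conj g h) -rmorphD. Qed.

Lemma innerL2Zr z f h : innerL2 h (z *: f) = z^*%C * innerL2 h f.
Proof. by rewrite innerL2_conj innerL2Zl (innerL2_conj f h) -rmorphM. Qed.

Lemma innerL2_suml (I : Type) (s : seq I) (F : I -> L2) h :
  innerL2 (\sum_(i <- s) F i) h = \sum_(i <- s) innerL2 (F i) h.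
Proof.
elim: s => [|i s IH]; first by rewrite !big_nil innerL20l.
by rewrite !big_cons innerL2Dl IH.
Qed.

Lemma normL2_sqrE f : normL2 f ^+ 2 = complex.Re (innerL2 f f).
Proof. by rewrite innerL2_self. Qed.

Lemma normL20 : normL2 (0 : L2) = 0.
Proof. by apply/eqP; rewrite -sqrf_eq0 normL2_sqrE innerL20l. Qed.

Lemma normL2_sqrD f g :
  normL2 (f + g) ^+ 2 = normL2 f ^+ 2 + 2 * complex.Re (innerL2 f g) + normL2 g ^+ 2.
Proof.
rewrite !normL2_sqrE innerL2Dl !innerL2Dr [innerL2 g f]innerL2_conj.
case: (innerL2 f f) (innerL2 f g) (innerL2 g g) => [? ?] [? ?] [? ?] /=; ring.
Qed.

Lemma normL2Z z f : normL2 (z *: f) = normc z * normL2 f.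
Proof.
apply/eqP; rewrite -(@eqrXn2 _ 2) ?normL2_ge0 ?mulr_ge0 ?normc_ge0 ?normL2_ge0//.
rewrite normL2_sqrE innerL2Zl innerL2Zr mulrA mul_conjc innerL2_self exprMn.
by rewrite -rmorphM.
Qed.

Lemma normL2N f : normL2 (- f) = normL2 f.
Proof. by rewrite -scaleN1r normL2Z normcN Normc.normc1 mul1r. Qed.

Lemma normL2B_sym f g : normL2 (f - g) = normL2 (g - f).
Proof. by rewrite -opprB normL2N. Qed.

Lemma cauchy_schwarz f g : normc (innerL2 f g) <= normL2 f * normL2 g.
Proof.
have [g0|g0] := eqVneq (normL2 g) 0.
  rewrite (normL2_eq0 g0) innerL2_conj innerL20l normc_conj Normc.normc0.
  by rewrite mulr_ge0 ?normL2_ge0.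
have gp : 0 < normL2 g by rewrite lt_neqAle eq_sym g0 normL2_ge0.
rewrite -(@ler_pXn2r _ 2) ?nnegrE ?normc_ge0 ?mulr_ge0 ?normL2_ge0// exprMn.
rewrite -ler_pdivrMr ?exprn_gt0//.
set G := normL2 g ^+ 2; have Gp : 0 < G by rewrite exprn_gt0.
set z := innerL2 f g.
have wz : ((- G^-1)%:C%C * z)^*%C * z = (- G^-1 * normc z ^+ 2)%:C%C.
  rewrite normc_sqr; case: z => a b; apply/eqP; rewrite eq_complex /=.
  by apply/andP; split; apply/eqP; ring.
have := sqr_ge0 (normL2 (f + ((- G^-1)%:C%C * z) *: g)).
rewrite normL2_sqrD normL2Z innerL2Zr -/z wz exprMn -/G Normc.normcM normcC.
rewrite normrN (gtr0_norm (_ : 0 < G^-1)) ?invr_gt0// exprMn.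
have -> : (G^-1 ^+ 2 * normc z ^+ 2) * G = normc z ^+ 2 / G.
  by field; rewrite gt_eqF.
by rewrite [complex.Re _](_ : _ = - G^-1 * normc z ^+ 2)//; lra.
Qed.

Lemma ler_normL2D f g : normL2 (f + g) <= normL2 f + normL2 g.
Proof.
rewrite -(@ler_pXn2r _ 2) ?nnegrE ?addr_ge0 ?normL2_ge0// normL2_sqrD sqrrD.
by have := le_trans (Re_le_normc _) (cauchy_schwarz f g); lra.
Qed.

Lemma ler_normL2B_trans f g h :
  normL2 (f - h) <= normL2 (f - g) + normL2 (g - h).
Proof. by rewrite -[f - h](subrKA g); exact: ler_normL2D. Qed.

Lemma ler_dist_normL2 f g : normL2 f <= normL2 g + normL2 (f - g).
Proof. by rewrite -[X in normL2 X <= _](subrK g) addrC ler_normL2D. Qed.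

End hilbert_geometry.

Arguments Normc.normc : simpl never.

(** * Consequences of completeness: uniform boundedness and coercive equations *)

Section hilbert_completeness.
Variables (R : realType) (d : nat).
Local Notation C := R[i].
Local Notation L2 := (L2 R d).
Local Notation normc := Normc.normc.
Implicit Types (f g h : L2) (z : C).

Lemma geometric_small (c q e : R) : 0 <= q -> q < 1 -> 0 < e ->
  exists N, forall n, (N <= n)%N -> c * q ^+ n <= e.
Proof.
move=> q0 q1 e0.
have : geometric c q n @[n --> \oo] --> 0 by apply: cvg_geometric; rewrite ger0_norm.
move=> /cvgrPdist_le/(_ e e0)[N _ H]; exists N => n /H.
by rewrite sub0r normrN; exact: le_trans (ler_norm _).
Qed.

Lemma geometric_le0 (x c q : R) : 0 <= q -> q < 1 ->
  (forall n, x <= c * q ^+ n) -> x <= 0.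
Proof.
move=> q0 q1 H; apply/ler_addgt0Pr => e e0; rewrite add0r.
by have [N /(_ N (leqnn N))] := geometric_small c q0 q1 e0; exact: le_trans.
Qed.

(** The tail K q^n / (1 - q) of the geometric series bounds the distance to the limit. *)
Lemma L2_geometric_cvg (u : nat -> L2) (K q : R) : 0 <= q -> q < 1 ->
  (forall n, normL2 (u n.+1 - u n) <= K * q ^+ n) ->
  exists s, forall n, normL2 (s - u n) <= K * q ^+ n / (1 - q).
Proof.
move=> q0 q1 uq.
have q1' : 0 < 1 - q by rewrite subr_gt0.
have K0 : 0 <= K.
  by have := le_trans (normL2_ge0 _) (uq 0%N); rewrite expr0 mulr1.
(* The factor 1 - q^k makes the induction on k close; it is dropped right after. *)
have H n k : normL2 (u (n + k)%N - u n) <= K * q ^+ n * (1 - q ^+ k) / (1 - q).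
  elim: k => [|k IH].
    by rewrite addn0 subrr normL20 expr0 subrr mulr0 mul0r.
  rewrite addnS; apply: le_trans (ler_normL2B_trans _ (u (n + k)%N) _) _.
  apply: le_trans (lerD (uq _) IH) _.
  rewrite ler_pdivlMr// mulrDl divfK ?gt_eqF// exprD exprS.
  by rewrite le_eqVlt; apply/orP; left; apply/eqP; ring.
have {}H n k : normL2 (u (n + k)%N - u n) <= K * q ^+ n / (1 - q).
  apply: le_trans (H n k) _; rewrite ler_pM2r ?invr_gt0//.
  by rewrite ler_piMr ?mulr_ge0 ?exprn_ge0// gerBl exprn_ge0.
have [|s sP] := @L2_complete R d u.
  move=> e e0; have e2 : 0 < e / 2 by rewrite divr_gt0.
  have [N NP] := geometric_small (K / (1 - q)) q0 q1 e2.
  have {}NP n : (N <= n)%N -> normL2 (u n - u N) <= e / 2.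
    move=> Nn; rewrite -(subnKC Nn); apply: le_trans (H _ _) _.
    by rewrite mulrAC; exact: NP.
  exists N => m n /NP Nm /NP Nn.
  apply: le_trans (ler_normL2B_trans _ (u N) _) _.
  by rewrite (splitr e) lerD// normL2B_sym.
exists s => n; apply/ler_addgt0Pl => e /sP[N NP].
apply: le_trans (ler_normL2B_trans _ (u (n + N)%N) _) _.
by rewrite lerD// NP// leq_addl.
Qed.

(** With b = (r / ||k||) k, the inner products of f + b and f - b with k differ by 2 r ||k||, so one
    of them has modulus at least r ||k||. *)
Lemma inner_increase f k (r : R) : 0 <= r ->
  exists g, normL2 (g - f) <= r /\ r * normL2 k <= normc (innerL2 g k).
Proof.
move=> r0; have [k0|k0] := eqVneq (normL2 k) 0.
  by exists f; rewrite subrr normL20 k0 mulr0 normc_ge0.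
pose b := (r / normL2 k)%:C%C *: k.
have kp : 0 < normL2 k by rewrite lt_neqAle eq_sym k0 normL2_ge0.
have nb : normL2 b = r.
  by rewrite normL2Z normcC ger0_norm ?divr_ge0 ?normL2_ge0// divfK.
have bk : innerL2 b k = (r * normL2 k)%:C%C.
  rewrite innerL2Zl innerL2_self -rmorphM; congr (_%:C%C).
  by rewrite expr2 mulrA divfK.
have nbk : normc (innerL2 b k) = r * normL2 k.
  by rewrite bk normcC ger0_norm// mulr_ge0// normL2_ge0.
have [h|h] := leP (r * normL2 k) (normc (innerL2 (f + b) k)).
  by exists (f + b); rewrite addrAC subrr add0r nb.
exists (f - b); rewrite addrAC subrr add0r normL2N nb; split=> //.
have : normc (innerL2 b k + innerL2 b k) <=
    normc (innerL2 (f + b) k) + normc (innerL2 (f - b) k).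
  rewrite -(normcN (innerL2 (f - b) k)); apply: le_trans (le_normcD _ _).
  rewrite innerL2Bl innerL2Dl le_eqVlt; apply/orP; left; apply/eqP.
  by congr normc; ring.
have -> : normc (innerL2 b k + innerL2 b k) = 2 * (r * normL2 k).
  by rewrite -mulr2n normcMn nbk mulr_natl.
lra.
Qed.

(* Sokal's gliding hump: the [n]th step moves the approximant by at most 3^-n,
   so that later steps, of total length at most 3^-n / 2, cannot undo more than
   half of what it gained. *)
Lemma uniform_boundedness (X : set L2) :
  (forall f, exists M, forall k, X k -> normc (innerL2 f k) <= M) ->
  exists M, forall k, X k -> normL2 k <= M.
Proof.
move=> ptw; apply: contrapT => unb.
have large (M : R) : exists k, X k /\ M < normL2 k.
  apply: contrapT => noM; apply: unb; exists M => k Xk.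
  by rewrite leNgt; apply/negP => Mk; apply: noM; exists k.
(* The norm exceeds 2 3^n n, so that half of the gain 3^-n ||k_n|| is still at least n. *)
have [k kP] := choice (fun n : nat => large (2 * 3 ^+ n * n%:R)).
have r0 n : 0 <= (3^-1 : R) ^+ n by rewrite exprn_ge0// invr_ge0.
have /choice[nxt nxtP] : forall p : nat * L2, exists g,
    normL2 (g - p.2) <= 3^-1 ^+ p.1 /\
    3^-1 ^+ p.1 * normL2 (k p.1) <= normc (innerL2 g (k p.1)).
  by move=> [n f]; exact: inner_increase.
pose x := fix x n : L2 := if n is m.+1 then nxt (m, x m) else 0.
have [|||s sP] := @L2_geometric_cvg x 1 3^-1.
- by rewrite invr_ge0.
- by rewrite invf_lt1 ?ltr1n.
- by move=> n; rewrite mul1r; have [] := nxtP (n, x n).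
have [M MP] := ptw s.
have [n Mn] : exists n, M < n%:R.
  by exists (Num.truncn `|M|).+1; rewrite (le_lt_trans (ler_norm M))// truncnS_gt.
have [Xk kn] := kP n; have := MP _ Xk.
apply/negP; rewrite -ltNge; apply: lt_le_trans Mn _.
have [_ /= big] := nxtP (n, x n); rewrite -/(x n.+1) in big.
have p3 : 0 < (3 : R) ^+ n by rewrite exprn_gt0.
have near_s : normc (innerL2 (s - x n.+1) (k n)) <= 3^-1 ^+ n / 2 * normL2 (k n).
  apply: le_trans (cauchy_schwarz _ _) _.
  rewrite ler_wpM2r ?normL2_ge0//; apply: le_trans (sP _) _.
  rewrite mul1r exprSr -mulrA ler_wpM2l// ler_pdivrMr; lra.
have tri : normc (innerL2 (x n.+1) (k n)) <=
    normc (innerL2 s (k n)) + normc (innerL2 (s - x n.+1) (k n)).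
  rewrite -(normcN (innerL2 (s - _) _)); apply: le_trans (le_normcD _ _).
  by rewrite innerL2Bl opprB addrC subrK.
have : n%:R <= 3^-1 ^+ n / 2 * normL2 (k n).
  by rewrite exprVn -invfM ler_pdivlMl ?mulr_gt0// [3 ^+ n * 2]mulrC ltW.
lra.
Qed.

Lemma linear_sub (T : L2 -> L2) : linear T -> {morph T : f g / f - g}.
Proof.
by move=> linT f g; rewrite -[f - g]addrC -scaleN1r linT scaleN1r addrC.
Qed.

Lemma linear_scale (T : L2 -> L2) : linear T -> scalable T.
Proof.
move=> linT a f; rewrite -[a *: f]addr0 linT.
suff -> : T 0 = 0 by rewrite addr0.
by rewrite -[X in T X](subrr 0) (linear_sub linT) subrr.
Qed.

(* The residual [y - T x] contracts under [x |-> x + t (y - T x)]; the step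
   [t = A / B^2] minimizes the factor [1 - 2 t A + t^2 B^2]. *)
Lemma lax_milgram (T : L2 -> L2) (A B : R) : linear T -> 0 < A -> A <= B ->
  (forall f, normL2 (T f) <= B * normL2 f) ->
  (forall f, A * normL2 f ^+ 2 <= complex.Re (innerL2 (T f) f)) ->
  forall y, exists x, T x = y.
Proof.
move=> linT A0 AB TB TA y.
have B0 : 0 < B := lt_le_trans A0 AB.
have TBr := linear_sub linT.
pose t := A / B ^+ 2.
have t0 : 0 < t by rewrite divr_gt0// exprn_gt0.
pose q2 := 1 - (A / B) ^+ 2.
have q20 : 0 <= q2.
  by rewrite subr_ge0 expr_le1 ?divr_ge0 ?(ltW A0) ?(ltW B0)// ler_pdivrMr// mul1r.
pose q := Num.sqrt q2.
have q0 : 0 <= q by exact: sqrtr_ge0.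
have q1 : q < 1.
  by rewrite -sqrtr1 ltr_sqrt// gtrBl exprn_gt0// divr_gt0.
pose x := fix x n : L2 := if n is m.+1 then x m + t%:C%C *: (y - T (x m)) else 0.
pose r n := y - T (x n).
have rS n : r n.+1 = r n - t%:C%C *: T (r n).
  rewrite /r /= [x n + _]addrC linT TBr opprD addrA addrAC.
  by rewrite scalerBr.
have contr f : normL2 (f - t%:C%C *: T f) <= q * normL2 f.
  rewrite -(@ler_pXn2r _ 2) ?nnegrE ?mulr_ge0 ?normL2_ge0//.
  rewrite exprMn [q ^+ 2]sqr_sqrtr// normL2_sqrD normL2N normL2Z normcC gtr0_norm//.
  have -> : complex.Re (innerL2 f (- (t%:C%C *: T f))) =
      - t * complex.Re (innerL2 (T f) f).
    rewrite -scaleN1r scalerA mulN1r -rmorphN innerL2Zr conjc_real.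
    rewrite (innerL2_conj (T f) f).
    by case: (innerL2 (T f) f) => a b /=; ring.
  have TB2 : normL2 (T f) ^+ 2 <= B ^+ 2 * normL2 f ^+ 2.
    by rewrite -exprMn ler_pXn2r ?nnegrE ?mulr_ge0 ?normL2_ge0// ltW.
  have h1 : t * (A * normL2 f ^+ 2) <= t * complex.Re (innerL2 (T f) f).
    by rewrite ler_pM2l.
  have h2 : t ^+ 2 * normL2 (T f) ^+ 2 <= t ^+ 2 * (B ^+ 2 * normL2 f ^+ 2).
    by rewrite ler_pM2l// exprn_gt0.
  have e1 : t * (A * normL2 f ^+ 2) = (A / B) ^+ 2 * normL2 f ^+ 2.
    by rewrite /t; field; rewrite gt_eqF.
  have e2 : t ^+ 2 * (B ^+ 2 * normL2 f ^+ 2) = (A / B) ^+ 2 * normL2 f ^+ 2.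
    by rewrite /t; field; rewrite gt_eqF.
  rewrite exprMn /q2 mulrBl mul1r; lra.
have rq n : normL2 (r n) <= normL2 (r 0%N) * q ^+ n.
  elim: n => [|n IH]; first by rewrite expr0 mulr1.
  rewrite rS; apply: le_trans (contr _) _.
  by rewrite exprS mulrCA ler_wpM2l.
have [||n|s sP] := @L2_geometric_cvg x (t * normL2 (r 0%N)) q => //.
  rewrite /= addrAC subrr add0r normL2Z normcC gtr0_norm// -mulrA.
  by rewrite ler_pM2l// rq.
exists s; apply/eqP; rewrite -subr_eq0; apply/eqP/normL2_eq0/eqP.
rewrite eq_le normL2_ge0 andbT.
(* Both ||s - x_n|| and the residual are bounded by multiples of q^n, so the norm of T s - y, which
   is free of n, is 0. *)
apply: (@geometric_le0 _ (B * (t * normL2 (r 0%N) / (1 - q)) + normL2 (r 0%N)) q) => // n.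
apply: le_trans (ler_normL2B_trans _ (T (x n)) _) _.
rewrite -TBr mulrDl lerD//; last by rewrite normL2B_sym rq.
apply: le_trans (TB _) _; rewrite -mulrA ler_pM2l//.
by apply: le_trans (sP n) _; rewrite mulrAC.
Qed.

End hilbert_completeness.

(* Unconditional sums in [L2] *)
#[local] Existing Instance totally_filter.

Section unconditional_sums.
Local Open Scope ring_scope.
Variables (R : realType) (d : nat) (I : choiceType).
Local Notation C := R[i].
Local Notation L2 := (L2 R d).
Local Notation normc := Normc.normc.
Implicit Types (e : I -> L2) (f g h s : L2) (c : I -> C) (F G : {fset I}).

Lemma partial_sumE e F : partial_sum e F = \sum_(i <- F) e i.
Proof. by rewrite big_seq_fsetE. Qed.

(** Thresholds [F0] replace the filter, so that two requirements can be met together on a union. *)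
Lemma has_sumP e s :
  has_sum e s <-> forall eps : R, 0 < eps -> exists F0, forall F, (F0 `<=` F)%fset ->
    normL2 (s - \sum_(i <- F) e i) <= eps.
Proof.
split=> [|H].
  move=> /cvgrPdist_le H eps eps0; have [F0 _ F0P] := H _ eps0.
  exists F0 => F /F0P /=; rewrite sub0r normrN partial_sumE.
  exact: le_trans (ler_norm _).
apply/cvgrPdist_le => eps /H[F0 F0P]; exists F0 => // F /F0P /=.
by rewrite sub0r normrN partial_sumE ger0_norm// normL2_ge0.
Qed.

Lemma has_sum_unique e s s' : has_sum e s -> has_sum e s' -> s = s'.
Proof.
move=> /has_sumP es /has_sumP es'; apply/eqP; rewrite -subr_eq0.
apply/eqP/normL2_eq0/eqP; rewrite eq_le normL2_ge0 andbT.
apply/ler_addgt0Pr => eps eps0; rewrite add0r.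
have e2 : 0 < eps / 2 by rewrite divr_gt0.
have [F FP] := es _ e2; have [G GP] := es' _ e2.
apply: le_trans (ler_normL2B_trans _ (\sum_(i <- (F `|` G)%fset) e i) _) _.
rewrite (splitr eps); apply: lerD; first exact/FP/fsubsetUl.
by rewrite normL2B_sym; exact/GP/fsubsetUr.
Qed.

Lemma eq_has_sum e e' s : e =1 e' -> has_sum e s -> has_sum e' s.
Proof. by move=> /funext ->. Qed.

Lemma linear_image_sum (T : L2 -> L2) (r : seq I) e : linear T ->
  T (\sum_(i <- r) e i) = \sum_(i <- r) T (e i).
Proof.
move=> linT; elim: r => [|i r IH].
  by rewrite !big_nil -(scale0r 0) (linear_scale linT) !scale0r.
by rewrite !big_cons -[e i]scale1r linT !scale1r IH.
Qed.

Lemma has_sum_linear (T : L2 -> L2) (M : R) e s : linear T ->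
  (forall f, normL2 (T f) <= M * normL2 f) ->
  has_sum e s -> has_sum (T \o e) (T s).
Proof.
move=> linT TM /has_sumP es; apply/has_sumP => eps eps0.
have M0 : 0 < `|M| + 1 by rewrite ltr_wpDl.
have [F0 F0P] := es (eps / (`|M| + 1)) (divr_gt0 eps0 M0).
exists F0 => F /F0P sF.
have -> : T s - \sum_(i <- F) (T \o e) i = T (s - \sum_(i <- F) e i).
  by rewrite linear_sub// (linear_image_sum _ _ linT).
apply: le_trans (TM _) _; rewrite ler_pdivlMr// mulrC in sF.
apply: le_trans sF; rewrite ler_wpM2r ?normL2_ge0//.
by rewrite (le_trans (ler_norm _))// lerDl.
Qed.

Lemma has_sumDZ (a : C) e e' s s' : has_sum e s -> has_sum e' s' ->
  has_sum (fun i => a *: e i + e' i) (a *: s + s').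
Proof.
move=> es /has_sumP es'.
have /has_sumP {}es : has_sum (fun i => a *: e i) (a *: s).
  apply: (has_sum_linear (T := fun f => a *: f) (M := normc a)) es => //.
    by move=> b f g; rewrite scalerDr !scalerA mulrC.
  by move=> f; rewrite normL2Z.
apply/has_sumP => eps eps0.
have e2 : 0 < eps / 2 by rewrite divr_gt0.
have [F FP] := es _ e2; have [G GP] := es' _ e2.
exists (F `|` G)%fset => H; rewrite fsubUset => /andP[FH GH].
rewrite big_split/= opprD addrACA; apply: le_trans (ler_normL2D _ _) _.
by rewrite (splitr eps); apply: lerD; [exact: FP|exact: GP].
Qed.

Lemma has_sum_reindex (p q : I -> I) e s : cancel p q -> cancel q p ->
  has_sum e s -> has_sum (e \o p) s.
Proof.
move=> pK qK /has_sumP es; apply/has_sumP => eps /es[F0 F0P].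
(* A finite set that contains q(F0) is mapped by p onto one that contains F0. *)
exists [fset q i | i in F0]%fset => F sF.
have -> : \sum_(i <- F) (e \o p) i = \sum_(i <- [fset p i | i in F]%fset) e i.
  by rewrite big_imfset//= => x y _ _; exact: can_inj pK _ _.
apply: F0P; apply/fsubsetP => i iF0; apply/imfsetP; exists (q i) => //.
by apply: (fsubsetP sF); apply/imfsetP; exists i.
Qed.

Lemma has_sum_normL2_le e s (K : R) :
  (forall F, normL2 (\sum_(i <- F) e i) <= K) -> has_sum e s -> normL2 s <= K.
Proof.
move=> eK /has_sumP es; apply/ler_addgt0Pr => eps /es[F /(_ F (fsubset_refl F))].
by move=> sF; apply: le_trans (ler_dist_normL2 _ (\sum_(i <- F) e i)) _; exact: lerD.
Qed.

(** Cauchy-Schwarz passes convergence on to inner products; adding 1 to ||h|| keeps the divisor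
    positive when h = 0. *)
Lemma has_sum_inner e s h (eps : R) : has_sum e s -> 0 < eps ->
  exists F0, forall F, (F0 `<=` F)%fset ->
    normc (innerL2 s h - \sum_(i <- F) innerL2 (e i) h) <= eps.
Proof.
move=> /has_sumP es eps0.
have n0 : 0 < normL2 h + 1 by rewrite ltr_wpDl ?normL2_ge0.
have [F0 F0P] := es (eps / (normL2 h + 1)) (divr_gt0 eps0 n0).
exists F0 => F /F0P sF.
rewrite -innerL2_suml -innerL2Bl; apply: le_trans (cauchy_schwarz _ _) _.
apply: (@le_trans _ _ (normL2 (s - \sum_(i <- F) e i) * (normL2 h + 1))).
  by rewrite ler_wpM2l ?normL2_ge0// lerDl.
by rewrite -ler_pdivlMr.
Qed.

(** Completeness concerns sequences, so the net is followed along thresholds [G n] for 1/(n+1). Two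
    of them are compared through their union, and every finite set above [G n] gives a sum close to
    [u n]. *)
Lemma has_sum_cauchy e :
  (forall eps : R, 0 < eps -> exists F0, forall F, (F0 `<=` F)%fset ->
    normL2 (\sum_(i <- F) e i - \sum_(i <- F0) e i) <= eps) ->
  exists s, has_sum e s.
Proof.
move=> cauchy_e.
have inv0 n : 0 < (n.+1%:R : R)^-1 by rewrite invr_gt0.
have [G GP] := choice (fun n => cauchy_e _ (inv0 n)).
pose u n := \sum_(i <- G n) e i.
have small (eps : R) : 0 < eps -> exists N, forall n, (N <= n)%N -> n.+1%:R^-1 <= eps.
  move=> eps0; exists (Num.truncn eps^-1) => n Nn.
  rewrite -[leRHS]invrK lef_pV2 ?posrE ?invr_gt0//.
  apply: le_trans (ltW (truncnS_gt _)) _; by rewrite ler_nat.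
have [|s sP] := @L2_complete R d u.
  move=> eps eps0; have [N NP] := small (eps / 2) (divr_gt0 eps0 (ltr0Sn _ 1)).
  exists N => m n /NP Nm /NP Nn.
  apply: le_trans (ler_normL2B_trans _ (\sum_(i <- (G m `|` G n)%fset) e i) _) _.
  rewrite (splitr eps); apply: lerD.
    by rewrite normL2B_sym; apply: le_trans (GP _ _ _) Nm; rewrite fsubsetUl.
  by apply: le_trans (GP _ _ _) Nn; rewrite fsubsetUr.
exists s; apply/has_sumP => eps eps0.
have e2 : 0 < eps / 2 by rewrite divr_gt0.
have [N1 N1P] := small _ e2; have [N2 N2P] := sP _ e2.
pose n := maxn N1 N2; exists (G n) => F nF.
apply: le_trans (ler_normL2B_trans _ (u n) _) _.
rewrite (splitr eps); apply: lerD; first exact/N2P/leq_maxr.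
rewrite normL2B_sym; apply: le_trans (GP n _ nF) _.
by rewrite N1P// leq_maxl.
Qed.

Lemma sum_fsetD (V : zmodType) (a : I -> V) F0 F : (F0 `<=` F)%fset ->
  \sum_(i <- F) a i = \sum_(i <- F0) a i + \sum_(i <- (F `\` F0)%fset) a i.
Proof.
move=> F0F; rewrite (big_fsetID _ (mem F0)) /=; congr (_ + _); apply: eq_fbigl => i.
  by rewrite !inE /= andbC; case: (boolP (i \in F0)) => //= /(fsubsetP F0F) ->.
by rewrite !inE /= andbC.
Qed.

(** The extended sum of nonnegative terms is the supremum of the finite sums; this brings the frame
    inequalities down to the reals. *)
Lemma esum_leP (a : I -> R) (K : R) : (forall i, 0 <= a i) ->
  (\esum_(i in [set: I]) (a i)%:E <= K%:E)%E <->
  forall F, \sum_(i <- F) a i <= K.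
Proof.
move=> a0; split=> [H F|H].
  rewrite -lee_fin; apply: le_trans H; apply: ereal_sup_ubound => /=.
  exists [set` F]; first by split => //; exact: finite_fset.
  by rewrite fsbig_finite ?finite_fset//= set_fsetK sumEFin.
apply: ge_ereal_sup => _ /= [A [fA _] <-].
by rewrite fsbig_finite//= sumEFin lee_fin.
Qed.

End unconditional_sums.

(** * Bessel families, frames and the frame operator *)

Section frames.
Variables (R : realType) (d : nat) (I : choiceType).
Local Notation C := R[i].
Local Notation L2 := (L2 R d).
Local Notation normc := Normc.normc.
Implicit Types (e : I -> L2) (f g h s : L2) (c : I -> C) (F G : {fset I}).

Definition bessel e (B : R) : Prop :=
  forall f F, \sum_(i <- F) normc (innerL2 f (e i)) ^+ 2 <= B * normL2 f ^+ 2.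

(** [K] runs over the real upper bounds of the finite sums: A ||f||^2 is at most their supremum,
    expressed without extended reals. *)
Definition lower_frame_bound e (A : R) : Prop :=
  forall f K, (forall F, \sum_(i <- F) normc (innerL2 f (e i)) ^+ 2 <= K) ->
    A * normL2 f ^+ 2 <= K.

Lemma is_frame_bounds e : is_frame e ->
  exists A B : R, [/\ 0 < A, A <= B, bessel e B & lower_frame_bound e A].
Proof.
move=> [A [B [A0 AB eAB]]]; exists A, B; split=> // [f|f K fK].
  by have /andP[_ /esum_leP] := eAB f; apply=> i; exact: sqr_ge0.
have /andP[le _] := eAB f; rewrite -lee_fin; apply: le_trans le _.
by apply/esum_leP => // i; exact: sqr_ge0.
Qed.

Lemma is_frame_of_bounds e (A B : R) :
  0 < A -> bessel e B -> lower_frame_bound e A -> is_frame e.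
Proof.
(* [is_frame] asks for ordered bounds, hence the maximum. *)
move=> A0 eB eA; exists A, (Num.max A B); split=> // [|f].
  by rewrite le_max lexx.
have nn i : 0 <= normc (innerL2 f (e i)) ^+ 2 by exact: sqr_ge0.
have up : (\esum_(i in [set: I]) (normc (innerL2 f (e i)) ^+ 2)%:E <=
    (Num.max A B * normL2 f ^+ 2)%:E)%E.
  apply/esum_leP => // F; apply: le_trans (eB f F) _.
  by rewrite ler_wpM2r ?sqr_ge0// le_max lexx orbT.
rewrite up andbT.
(* Finiteness allows the extended sum itself to serve as the real [K] of the lower bound. *)
have fin : (\esum_(i in [set: I]) (normc (innerL2 f (e i)) ^+ 2)%:E)%E \is a fin_num.
  rewrite ge0_fin_numE; first exact: le_lt_trans up (ltry _).
  by apply: esum_ge0 => i _; rewrite lee_fin.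
rewrite -(fineK fin) lee_fin; apply: eA.
by apply/esum_leP => //; rewrite fineK.
Qed.

(** Write ||s||^2 as the sum of c_i <e_i, s> and bound each term by (B |c_i|^2 + |<s, e_i>|^2 / B) /
    2. By the Bessel inequality the second halves add up to at most ||s||^2 / 2, which is absorbed
    on the left. *)
Lemma bessel_synthesis_le e (B : R) c F : 0 < B -> bessel e B ->
  normL2 (\sum_(i <- F) c i *: e i) ^+ 2 <= B * \sum_(i <- F) normc (c i) ^+ 2.
Proof.
move=> B0 eB; set s := \sum_(i <- F) _.
have key : normL2 s ^+ 2 <=
    \sum_(i <- F) (B * normc (c i) ^+ 2 + normc (innerL2 s (e i)) ^+ 2 / B) / 2.
  rewrite normL2_sqrE {1}/s innerL2_suml; apply: le_trans (Re_le_normc _) _.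
  elim: (enum_fset F) => [|i r IH].
    by rewrite !big_nil Normc.normc0.
  rewrite !big_cons; apply: le_trans (le_normcD _ _) (lerD _ IH).
  rewrite innerL2Zl Normc.normcM (innerL2_conj s (e i)) normc_conj.
  move: (normc (c i)) (normc (innerL2 s (e i))) => x y.
  have -> : (B * x ^+ 2 + y ^+ 2 / B) / 2 = x * y + (B * x - y) ^+ 2 / (2 * B).
    by field; rewrite gt_eqF.
  by rewrite lerDl divr_ge0 ?sqr_ge0// mulr_ge0// ltW.
move: key; rewrite -mulr_suml big_split/= -mulr_sumr -mulr_suml.
have : (\sum_(i <- F) normc (innerL2 s (e i)) ^+ 2) / B <= normL2 s ^+ 2.
  by rewrite ler_pdivrMr// mulrC eB.
lra.
Qed.

(** Choose [F0] with coefficient sum within eps^2 / B of the supremum: the coefficients outside [F0]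
    then carry less than eps^2 / B, and the synthesis bound makes the net of sums Cauchy. *)
Lemma bessel_synthesis e (B K : R) c : 0 < B -> bessel e B ->
  (forall F, \sum_(i <- F) normc (c i) ^+ 2 <= K) ->
  exists s, has_sum (fun i => c i *: e i) s.
Proof.
move=> B0 eB cK; apply: has_sum_cauchy => eps eps0.
pose X := [set \sum_(i <- F) normc (c i) ^+ 2 | F in [set: {fset I}]].
have supX : has_sup X.
  split; first by exists (\sum_(i <- fset0) normc (c i) ^+ 2), fset0.
  by exists K => _ [F _ <-].
have d0 : 0 < eps ^+ 2 / B by rewrite divr_gt0// exprn_gt0.
have [_ [F0 _ <-] F0P] := sup_adherent d0 supX.
exists F0 => F F0F; rewrite (sum_fsetD _ F0F) addrAC subrr add0r.
rewrite -(@ler_pXn2r _ 2) ?nnegrE ?normL2_ge0 ?(ltW eps0)//.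
apply: le_trans (bessel_synthesis_le _ _ B0 eB) _.
rewrite mulrC -ler_pdivlMr//.
have : \sum_(i <- F) normc (c i) ^+ 2 <= sup X.
  by apply: ub_le_sup; [case: supX|exists F].
rewrite (sum_fsetD _ F0F) => h; rewrite -(lerD2l (\sum_(i <- F0) normc (c i) ^+ 2)).
by apply: le_trans h _; rewrite -lerBlDr ltW.
Qed.

Lemma bessel_analysis e (B : R) f : 0 < B -> bessel e B ->
  exists s, has_sum (fun i => innerL2 f (e i) *: e i) s.
Proof. by move=> B0 eB; exact: bessel_synthesis B0 eB (eB f). Qed.

(* Both sides are limits of the sums of [<h, e_i> <e_i, k>]: the frame operator
   is self-adjoint. *)
Lemma frame_operator_sym e f g h k :
  has_sum (fun i => innerL2 h (e i) *: e i) f ->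
  has_sum (fun i => innerL2 k (e i) *: e i) g ->
  innerL2 f k = innerL2 h g.
Proof.
move=> hf kg; apply/eqP; rewrite -subr_eq0; apply/eqP/Normc.eq0_normc/eqP.
rewrite eq_le normc_ge0 andbT; apply/ler_addgt0Pr => eps eps0; rewrite add0r.
have e2 : 0 < eps / 2 by rewrite divr_gt0.
have [F FP] := has_sum_inner k hf e2; have [G GP] := has_sum_inner h kg e2.
have {}FP := FP _ (fsubsetUl F G); have {}GP := GP _ (fsubsetUr F G).
set H := (F `|` G)%fset in FP GP.
set S := \sum_(i <- H) _ in FP; set S' := \sum_(i <- H) _ in GP.
have SS : S' = S^*%C.
  rewrite /S /S' rmorph_sum; apply: eq_bigr => i _.
  by rewrite !innerL2Zl (innerL2_conj h) (innerL2_conj (e i) k) mulrC -rmorphM.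
have -> : innerL2 f k - innerL2 h g =
    (innerL2 f k - S) - (innerL2 g h - S')^*%C.
  by rewrite SS (innerL2_conj h g) -rmorphB conjcK opprB addrA subrK.
apply: le_trans (le_normcD _ _) _.
by rewrite (splitr eps) normcN normc_conj; exact: lerD.
Qed.

(** Synthesis and Bessel inequalities bound the finite sums, hence ||f||. For the lower bound, <f,
    h> is the limit of the sums of |<h, e_i>|^2. *)
Lemma frame_operator_bounds e (A B : R) f h : 0 < B -> bessel e B ->
  lower_frame_bound e A -> has_sum (fun i => innerL2 h (e i) *: e i) f ->
  normL2 f <= B * normL2 h /\ A * normL2 h ^+ 2 <= complex.Re (innerL2 f h).
Proof.
move=> B0 eB eA hf; split.
  apply: has_sum_normL2_le hf => F.
  rewrite -(@ler_pXn2r _ 2) ?nnegrE ?mulr_ge0 ?normL2_ge0 ?(ltW B0)//.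
  apply: le_trans (bessel_synthesis_le _ _ B0 eB) _.
  by rewrite exprMn expr2 -mulrA ler_pM2l.
apply/ler_addgt0Pr => eps eps0; apply: eA => F.
have [F0 F0P] := has_sum_inner h hf eps0.
have /F0P FP := fsubsetUr F F0; set H := (F `|` F0)%fset in FP.
have SE : \sum_(i <- H) innerL2 (innerL2 h (e i) *: e i) h =
    (\sum_(i <- H) normc (innerL2 h (e i)) ^+ 2)%:C%C.
  rewrite rmorph_sum; apply: eq_bigr => i _.
  by rewrite innerL2Zl (innerL2_conj h) mul_conjc.
rewrite SE in FP.
apply: (@le_trans _ _ (\sum_(i <- H) normc (innerL2 h (e i)) ^+ 2)).
  rewrite (sum_fsetD _ (fsubsetUl F F0 : (F `<=` H)%fset)) lerDl.
  by apply: sumr_ge0 => i _; exact: sqr_ge0.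
have : complex.Re ((\sum_(i <- H) normc (innerL2 h (e i)) ^+ 2)%:C%C - innerL2 f h) <= eps.
  by apply: le_trans (Re_le_normc _) _; rewrite normcB_sym.
case: (innerL2 f h) => a b /=; lra.
Qed.

(** The frame operator is linear by uniqueness of sums, bounded by B and coercive with constant A,
    so [lax_milgram] applies. *)
Lemma frame_operator_surj e : is_frame e ->
  forall f, exists h, has_sum (fun i => innerL2 h (e i) *: e i) f.
Proof.
move=> /is_frame_bounds[A [B [A0 AB eB eA]]].
have B0 : 0 < B := lt_le_trans A0 AB.
have [S SP] := choice (fun h => bessel_analysis h B0 eB).
have linS : linear S.
  move=> a u v; apply: has_sum_unique (SP _) _.
  apply: eq_has_sum (has_sumDZ a (SP u) (SP v)) => i /=.
  by rewrite innerL2DZl scalerDl scalerA.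
have SB f : normL2 (S f) <= B * normL2 f.
  by have [] := frame_operator_bounds B0 eB eA (SP f).
have SA f : A * normL2 f ^+ 2 <= complex.Re (innerL2 (S f) f).
  by have [] := frame_operator_bounds B0 eB eA (SP f).
by move=> f; have [h <-] := lax_milgram linS A0 AB SB SA f; exists h.
Qed.

(** With S the sum of |<f, T e_i>|^2 and s the sum of <f, T e_i> e_i, one has S = <T s, f> <= M
    ||s|| ||f|| and ||s||^2 <= B S. Square the first, insert the second and cancel S. *)
Lemma bessel_image e (B M : R) (T : L2 -> L2) : 0 < B -> bessel e B ->
  linear T -> (forall f, normL2 (T f) <= M * normL2 f) ->
  bessel (T \o e) (B * M ^+ 2).
Proof.
move=> B0 eB linT TM f F.
set S := \sum_(i <- F) _.
have S0 : 0 <= S by apply: sumr_ge0 => i _; exact: sqr_ge0.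
pose s := \sum_(i <- F) innerL2 f (T (e i)) *: e i.
have SE : S%:C%C = innerL2 (T s) f.
  rewrite (linear_image_sum _ _ linT) innerL2_suml rmorph_sum; apply: eq_bigr => i _.
  by rewrite (linear_scale linT) innerL2Zl (innerL2_conj f) mul_conjc.
have S1 : S <= M * normL2 s * normL2 f.
  have : normc S%:C%C <= M * normL2 s * normL2 f.
    rewrite SE; apply: le_trans (cauchy_schwarz _ _) _.
    by rewrite ler_wpM2r ?normL2_ge0.
  by rewrite normcC ger0_norm.
have S2 : normL2 s ^+ 2 <= B * S := bessel_synthesis_le _ _ B0 eB.
have [S00|Sn0] := eqVneq S 0.
  by rewrite S00 mulr_ge0 ?sqr_ge0// mulr_ge0 ?sqr_ge0// ltW.
have Sp : 0 < S by rewrite lt_neqAle eq_sym Sn0.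
have S3 : S ^+ 2 <= B * S * (M ^+ 2 * normL2 f ^+ 2).
  apply: (@le_trans _ _ ((M * normL2 s * normL2 f) ^+ 2)).
    by rewrite ler_pXn2r ?nnegrE// (le_trans _ S1).
  rewrite !exprMn mulrAC mulrC ler_wpM2r//.
  by rewrite mulr_ge0 ?sqr_ge0.
rewrite -(ler_pM2l Sp) -expr2; apply: le_trans S3 _.
by rewrite le_eqVlt; apply/orP; left; apply/eqP; ring.
Qed.

(* The vectors [k] with [sum_i |<k, T e_i>|^2 <= 1] are pointwise bounded, as
   [f = T h] expands along the [T e_i] with square-summable coefficients; the
   uniform boundedness principle then gives the lower bound. *)
Lemma frame_image e (M : R) (T : L2 -> L2) : is_frame e ->
  linear T -> (forall f, normL2 (T f) <= M * normL2 f) ->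
  (forall f, exists h, T h = f) -> is_frame (T \o e).
Proof.
move=> fr linT TM surjT.
have [A [B [A0 AB eB eA]]] := is_frame_bounds fr.
have B0 : 0 < B := lt_le_trans A0 AB.
have TeB := bessel_image B0 eB linT TM.
pose X := [set k | forall F, \sum_(i <- F) normc (innerL2 k (T (e i))) ^+ 2 <= 1].
have [|N NP] := @uniform_boundedness R d X.
  move=> f; have [h0 h0f] := surjT f; have [h hh0] := frame_operator_surj fr h0.
  (* A product of two coefficients is at most half the sum of their squares; the squares sum to at
     most B ||h||^2 for h and to at most 1 for k in [X]. *)
  exists ((B * normL2 h ^+ 2 + 1) / 2) => k Xk.
  have Tf := has_sum_linear linT TM hh0; rewrite h0f in Tf.
  apply/ler_addgt0Pr => eps eps0.
  have [F /(_ F (fsubset_refl F)) FP] := has_sum_inner k Tf eps0.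
  set S := \sum_(i <- F) _ in FP.
  have SB : normc S <= (B * normL2 h ^+ 2 + 1) / 2.
    apply: (@le_trans _ _ (\sum_(i <- F) (normc (innerL2 h (e i)) ^+ 2 +
        normc (innerL2 k (T (e i))) ^+ 2) / 2)).
      rewrite /S; elim: (enum_fset F) => [|i r IH].
        by rewrite !big_nil Normc.normc0.
      rewrite !big_cons; apply: le_trans (le_normcD _ _) (lerD _ IH).
      rewrite /= (linear_scale linT) innerL2Zl Normc.normcM (innerL2_conj k) normc_conj.
      by have := sqr_ge0 (normc (innerL2 h (e i)) - normc (innerL2 k (T (e i)))); nra.
    rewrite -mulr_suml big_split/= ler_pM2r ?invr_gt0//.
    by apply: lerD; [exact: eB|exact: Xk].
  rewrite -[innerL2 f k](subrK S); apply: le_trans (le_normcD _ _) _.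
  by rewrite addrC lerD.
pose N1 := `|N| + 1; have N10 : 0 < N1 by rewrite ltr_wpDl.
have {}NP k : X k -> normL2 k <= N1.
  by move=> /NP/le_trans; apply; rewrite (le_trans (ler_norm _))// lerDl.
have N20 : 0 < (N1 ^+ 2)^-1 by rewrite invr_gt0 exprn_gt0.
apply: (is_frame_of_bounds N20 TeB) => f K fK.
have K0 : 0 <= K by have := fK fset0; rewrite big_seq_fset0.
rewrite mulrC ler_pdivrMr ?exprn_gt0//.
(* If r > 0 and K <= r^2, then f / r lies in [X]. As sqrt K may be 0, this is used below with r =
   sqrt K + eps / N1 for arbitrary eps > 0. *)
have sc (r : R) : 0 < r -> K <= r ^+ 2 -> normL2 f <= N1 * r.
  move=> r0 Kr; have : X (r^-1%:C%C *: f).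
    move=> F; under eq_bigr do rewrite innerL2Zl Normc.normcM normcC exprMn.
    rewrite -mulr_sumr gtr0_norm ?invr_gt0// exprVn mulrC ler_pdivrMr ?exprn_gt0//.
    by rewrite mul1r; apply: le_trans Kr; exact: fK.
  move=> /NP; rewrite normL2Z normcC gtr0_norm ?invr_gt0// mulrC.
  by rewrite ler_pdivrMr.
have : normL2 f <= N1 * Num.sqrt K.
  apply/ler_addgt0Pr => eps eps0.
  have : normL2 f <= N1 * (Num.sqrt K + eps / N1).
    apply: sc; first by rewrite ltr_wpDl ?sqrtr_ge0// divr_gt0.
    rewrite -[leLHS](sqr_sqrtr K0) ler_pXn2r ?nnegrE ?sqrtr_ge0//; last first.
      by rewrite addr_ge0 ?sqrtr_ge0// divr_ge0 ?ltW.
    by rewrite lerDl divr_ge0 ?ltW.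
  by rewrite mulrDr [N1 * (_ / _)]mulrC divfK// gt_eqF.
move=> h; rewrite -[leRHS](_ : (N1 * Num.sqrt K) ^+ 2 = _); last first.
  by rewrite exprMn [Num.sqrt K ^+ 2]sqr_sqrtr// mulrC.
by rewrite ler_pXn2r ?nnegrE ?mulr_ge0 ?normL2_ge0 ?sqrtr_ge0// ltW.
Qed.

End frames.

(** * Time-frequency shifts: isometry and composition up to phases *)

Section time_frequency.
Local Open Scope quotient_scope.
Variables (R : realType) (d : nat).
Local Notation C := R[i].
Local Notation L2 := (L2 R d).
Local Notation mu := (lebesgue_cV R d).
Local Notation normc := Normc.normc.
Implicit Types (f g h : L2) (l m : 'cV[R]_(d + d)).

Lemma expiD (a b : R) : expi (a + b) = expi a * expi b.
Proof.
rewrite /expi cosD sinD; apply/eqP; rewrite eq_complex /=.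
by apply/andP; split; apply/eqP; ring.
Qed.

Lemma expi_conj (a : R) : expi a * (expi a)^*%C = 1.
Proof. by rewrite mul_conjc normc_expi expr1n. Qed.

Lemma dotRDl (v w x : 'cV[R]_d) : dotR (v + w) x = dotR v x + dotR w x.
Proof. by rewrite -big_split; apply: eq_bigr => i _; rewrite mxE mulrDl. Qed.

Lemma dotRBr (w x y : 'cV[R]_d) : dotR w (x - y) = dotR w x - dotR w y.
Proof. by rewrite -sumrB; apply: eq_bigr => i _; rewrite !mxE mulrBr. Qed.

Lemma pi_tfshift l (a : L2fun R d) : tfshift l (\pi_L2 a) =
  \pi_L2 (modulation_fun (usubmx l) (translation_fun (dsubmx l) a)).
Proof. by rewrite /tfshift pi_translation pi_modulation. Qed.

Lemma tfshift_linear l : linear (tfshift l : L2 -> L2).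
Proof.
move=> z f g; rewrite -[f]reprK -[g]reprK.
move: (repr f) (repr g) => a b.
rewrite pi_scalerL2 pi_addL2 !pi_tfshift pi_scalerL2 pi_addL2.
apply/L2_eqP/aeW => x /=.
set t := dsubmx l; set w := expi _.
rewrite -[LHS]/(w * (z * a (x - t) + b (x - t))).
by rewrite -[RHS]/(z * (w * a (x - t)) + w * b (x - t)) mulrDr mulrCA.
Qed.

Lemma normL2_modulation (w : 'cV[R]_d) f : normL2 (modulation w f) = normL2 f.
Proof.
rewrite -[f]reprK; move: (repr f) => a; rewrite pi_modulation !pi_normL2.
by congr Num.sqrt; apply: eq_Rintegral => x _; rewrite Normc.normcM normc_expi mul1r.
Qed.

Lemma normL2_translation (t : 'cV[R]_d) f : normL2 (translation t f) = normL2 f.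
Proof.
rewrite -[f]reprK; move: (repr f) => a; rewrite pi_translation !pi_normL2.
have [ma _] := L2funP a; have mt := measurable_shift_cV (- t).
congr (Num.sqrt (fine _)).
pose F (x : 'cV[R]_d) := (normc (a x) ^+ 2)%:E.
transitivity (\int[pushforward mu (fun x : 'cV[R]_d => (x - t)%R)]_y F y)%E.
  rewrite ge0_integral_pushforward//.
    by apply/measurable_EFinP; exact: measurable_normc_sqr.
  by move=> x _; rewrite lee_fin sqr_ge0.
by apply: eq_measure_integral => //= A mA _; exact: lebesgue_cV_shift.
Qed.

Lemma normL2_tfshift l f : normL2 (tfshift l f) = normL2 f.
Proof. by rewrite /tfshift normL2_modulation normL2_translation. Qed.

(** Moving the translation part of l past the modulation part of m costs the phase exp(-2 pi i w.t),
    with w the frequency of m and t the time shift of l. *)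
Lemma tfshiftD l m : exists2 z : C, z * z^*%C = 1 &
  forall f, tfshift l (tfshift m f) = z *: tfshift (l + m) f.
Proof.
exists (expi (- (2 * pi * dotR (usubmx m) (dsubmx l)))); first exact: expi_conj.
move=> f; rewrite -[f]reprK; move: (repr f) => a.
rewrite !pi_tfshift pi_scalerL2; apply/L2_eqP/aeW => x /=.
rewrite -[RHS]/(expi _ * (expi _ * a _)) !mulrA -!expiD; congr (expi _ * a _).
  by rewrite dotRBr linearD/= dotRDl; ring.
by rewrite linearD/= opprD addrA addrAC.
Qed.

(** Polarization: norms of sums determine the real part, and Im <h, k> = Re <h, i k>. *)
Lemma isometry_inner (T : L2 -> L2) f g : linear T ->
  (forall h, normL2 (T h) = normL2 h) -> innerL2 (T f) (T g) = innerL2 f g.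
Proof.
move=> linT Tn.
have reT h k : complex.Re (innerL2 (T h) (T k)) = complex.Re (innerL2 h k).
  have TD : T (h + k) = T h + T k by rewrite -[h]scale1r linT !scale1r.
  have := normL2_sqrD (T h) (T k); rewrite -TD !Tn normL2_sqrD; lra.
have imE h k : complex.Im (innerL2 h k) = complex.Re (innerL2 h ('i%C *: k)).
  by rewrite innerL2Zr; case: (innerL2 h k) => a b /=; ring.
apply/eqP; rewrite eq_complex reT !imE -(linear_scale linT) reT.
by rewrite !eqxx.
Qed.

Lemma inner_tfshift l f g : innerL2 (tfshift l f) (tfshift l g) = innerL2 f g.
Proof. exact/isometry_inner/normL2_tfshift/tfshift_linear. Qed.

End time_frequency.

(** * Gabor systems over a lattice, dual windows and multipliers *)

Section gabor.
Variables (R : realType) (d : nat) (Lam : set 'cV[R]_(d + d)).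
Local Notation C := R[i].
Local Notation L2 := (L2 R d).
Local Notation normc := Normc.normc.
Implicit Types (f g h u v : L2) (l m : 'cV[R]_(d + d)).

Lemma latticeD l m : is_lattice Lam -> Lam l -> Lam m -> Lam (l + m).
Proof.
move=> [A _ ->] [a _ <-] [b _ <-]; exists (a + b) => //.
by rewrite map_mxD mulmxDr.
Qed.

Lemma latticeN l : is_lattice Lam -> Lam l -> Lam (- l).
Proof.
move=> [A _ ->] [a _ <-]; exists (- a) => //.
by rewrite map_mxN mulmxN.
Qed.

Local Notation gabor_sum u v f :=
  (has_sum (fun i => innerL2 f (@gabor_system R d Lam u i) *: @gabor_system R d Lam v i)).

(** Apply the isometry pi(l) termwise, then shift the index by l. Both windows acquire the same
    phase, which enters conjugated through the coefficient and unconjugated through the vector. *)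
Lemma gabor_sum_tfshift u v f s l : is_lattice Lam -> Lam l ->
  gabor_sum u v f s -> gabor_sum u v (tfshift l f) (tfshift l s).
Proof.
move=> hLam Ll fs.
(* The default value [k] of [insubd] is never taken, as adding l or -l stays in the lattice. *)
pose p (k : Lam) : Lam := insubd k (l + val k).
pose q (k : Lam) : Lam := insubd k (- l + val k).
have vp k : val (p k) = l + val k.
  rewrite insubdK//; apply/mem_set; apply: latticeD => //; exact: set_valP.
have vq k : val (q k) = - l + val k.
  rewrite insubdK//; apply/mem_set; apply: latticeD => //; [exact: latticeN|exact: set_valP].
have pK : cancel p q by move=> k; apply: val_inj; rewrite vq vp addKr.
have qK : cancel q p by move=> k; apply: val_inj; rewrite vp vq addNKr.
have Tl h : normL2 (tfshift l h) <= 1 * normL2 h by rewrite normL2_tfshift mul1r.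
have Tfs := has_sum_linear (tfshift_linear l) Tl fs.
apply: eq_has_sum (has_sum_reindex qK pK Tfs) => k /=.
rewrite (linear_scale (@tfshift_linear _ _ l)) /gabor_system.
have [z z1 zP] := tfshiftD l (val (q k)).
have lk : l + val (q k) = val k by rewrite -vp qK.
rewrite -(inner_tfshift l f) !zP lk innerL2Zr scalerA.
by rewrite mulrAC [_ * z]mulrC z1 mul1r.
Qed.

(** M (pi(l) f) and pi(l) (M f) are sums of one and the same series. *)
Lemma gabor_multiplier_commutes u v (M : L2 -> L2) : is_lattice Lam ->
  is_multiplier (fun=> 1) (@gabor_system R d Lam v) (@gabor_system R d Lam u) M ->
  forall l, Lam l -> forall f, M (tfshift l f) = tfshift l (M f).
Proof.
move=> hLam MP l Ll f; apply: has_sum_unique (MP _) _.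
have Mf : gabor_sum u v f (M f) by apply: eq_has_sum (MP f) => i; rewrite mul1r.
by apply: eq_has_sum (gabor_sum_tfshift hLam Ll Mf) => i; rewrite mul1r.
Qed.

(** Let S be the frame operator of g and S u = g. For f = S h, symmetry and commutation turn <f,
    pi(l) u> into <h, pi(l) g>, whose series along the pi(l) g sums to S h = f. *)
Lemma gabor_dual g : is_lattice Lam -> is_gabor_frame Lam g ->
  exists2 u, is_gabor_frame Lam u & forall f, gabor_sum u g f f.
Proof.
move=> hLam frg; have [A [B [A0 AB eB eA]]] := is_frame_bounds frg.
have B0 : 0 < B := lt_le_trans A0 AB.
have [u ug] := frame_operator_surj frg g.
have coef f h : gabor_sum g g h f -> forall i : Lam,
    innerL2 f (gabor_system u i) = innerL2 h (gabor_system g i).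
  move=> hf i; apply: frame_operator_sym hf _.
  by apply: gabor_sum_tfshift hLam _ ug; exact: set_valP.
exists u; last first.
  move=> f; have [h hf] := frame_operator_surj frg f.
  by apply: (eq_has_sum _ hf) => i; rewrite (coef _ _ hf).
(* For S h = f one has A ||h|| <= ||f|| <= B ||h||; the frame bounds of g at h then yield A / B^2
   and B / A^2 for u. *)
have A20 : 0 < A / B ^+ 2 by rewrite divr_gt0// exprn_gt0.
apply: (is_frame_of_bounds (B := B / A ^+ 2) A20) => [f F|f K fK].
  have [h hf] := frame_operator_surj frg f.
  have [_ hA] := frame_operator_bounds B0 eB eA hf.
  under eq_bigr do rewrite (coef _ _ hf).
  apply: le_trans (eB h F) _; rewrite -mulrA ler_pM2l// ler_pdivlMl ?exprn_gt0//.
  rewrite -exprMn ler_pXn2r ?nnegrE ?mulr_ge0 ?normL2_ge0 ?(ltW A0)//.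
  have [h0|h0] := eqVneq (normL2 h) 0; first by rewrite h0 mulr0 normL2_ge0.
  have hp : 0 < normL2 h by rewrite lt_neqAle eq_sym h0 normL2_ge0.
  rewrite -(ler_pM2r hp) -mulrA -expr2; apply: le_trans hA _.
  exact: le_trans (Re_le_normc _) (cauchy_schwarz _ _).
have [h hf] := frame_operator_surj frg f.
have [hB _] := frame_operator_bounds B0 eB eA hf.
have hK : A * normL2 h ^+ 2 <= K.
  by apply: eA => F; apply: le_trans (fK F); under [leRHS]eq_bigr do rewrite (coef _ _ hf).
apply: le_trans hK; rewrite mulrAC -mulrA ler_pM2l// ler_pdivrMr ?exprn_gt0//.
by rewrite mulrC -exprMn ler_pXn2r ?nnegrE ?mulr_ge0 ?normL2_ge0 ?(ltW B0).
Qed.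

Lemma gabor_multiplier_of_commute g u (V : L2 -> L2) (M : R) :
  linear V -> (forall f, normL2 (V f) <= M * normL2 f) ->
  (forall f, gabor_sum u g f f) ->
  (forall l, Lam l -> V (tfshift l g) = tfshift l (V g)) ->
  is_multiplier (fun=> 1) (@gabor_system R d Lam (V g)) (@gabor_system R d Lam u) V.
Proof.
move=> linV VM ug Vg f.
apply: eq_has_sum (has_sum_linear linV VM (ug f)) => i /=.
by rewrite mul1r (linear_scale linV) [V _]Vg//; exact: set_valP.
Qed.

Lemma gabor_frame_image g (V : L2 -> L2) (M : R) :
  linear V -> (forall f, normL2 (V f) <= M * normL2 f) ->
  (forall f, exists h, V h = f) ->
  (forall l, Lam l -> V (tfshift l g) = tfshift l (V g)) ->
  is_gabor_frame Lam g -> is_gabor_frame Lam (V g).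
Proof.
move=> linV VM surjV Vg frg.
have := frame_image frg linV VM surjV.
rewrite (_ : V \o _ = @gabor_system R d Lam (V g))//.
by apply/funext => i /=; rewrite [V _]Vg//; exact: set_valP.
Qed.

End gabor.

(** * The cycle of implications between the four statements *)

Theorem theorem5p1 (R : realType) (d : nat) (Lam : set 'cV[R]_(d + d))
    (g : L2 R d) (V : {linear L2 R d -> L2 R d}) (Vinv : L2 R d -> L2 R d)
    (hLam : is_lattice Lam) (hg : is_gabor_frame Lam g)
    (hV : bounded_operator V) (hVK : cancel V Vinv) (hVinvK : cancel Vinv V) :
  [<-> (* A1 *)
       forall l, Lam l -> V (tfshift l g) = tfshift l (V g);
       (* A2 *)
       forall l, Lam l -> forall f, V (tfshift l f) = tfshift l (V f);
       (* A3 *)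
       is_gabor_frame_multiplier1 Lam V;
       (* A4 *)
       is_gabor_frame_multiplier1 Lam Vinv].
Proof.
have [M VM] := hV; have linV : linear V := linearP V.
have surjV f : exists h, V h = f by exists (Vinv f).
have [u fru ug] := gabor_dual hLam hg.
tfae.
(* The passage from g to all f goes through the multiplier form of V with windows [u] and [V g]. *)
- move=> Vg; apply: (gabor_multiplier_commutes hLam (u := u) (v := V g)).
  exact: gabor_multiplier_of_commute.
- move=> VC; exists u, (V g); split; first exact: fru.
    by apply: gabor_frame_image VM _ _ hg => // l Ll; exact: VC.
  by apply: gabor_multiplier_of_commute VM ug _ => // l Ll; exact: VC.
- move=> [u' [v' [_ _ VP]]].
  have VC l : Lam l -> V (tfshift l g) = tfshift l (V g).
    by move=> Ll; exact: (gabor_multiplier_commutes hLam VP Ll).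
  have frVg := gabor_frame_image linV VM surjV VC hg.
  have [w frw wVg] := gabor_dual hLam frVg.
  exists w, g; split; [exact: frw|exact: hg|move=> f].
  have [A [B [A0 AB gB _]]] := is_frame_bounds hg.
  have [_ [B' [_ _ wB _]]] := is_frame_bounds frw.
  (* The coefficients <f, pi(l) w> are square-summable, so their series along the pi(l) g converges;
     V maps it to the expansion of f along the pi(l) V g, so its sum is [Vinv f]. *)
  have [s ws] := bessel_synthesis (lt_le_trans A0 AB) gB (wB f).
  suff <- : s = Vinv f by apply: eq_has_sum ws => i; rewrite mul1r.
  apply: (can_inj hVK); rewrite hVinvK; apply: has_sum_unique (wVg f).
  apply: eq_has_sum (has_sum_linear linV VM ws) => i /=.
  by rewrite (linear_scale linV) [V _]VC//; exact: set_valP.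
- move=> [u' [v' [_ _ VP]]] l Ll.
  (* [Vinv] is injective and, as a multiplier, commutes with pi(l), so it suffices to compare the
     images of both sides under it. *)
  apply: (can_inj hVinvK); rewrite hVK.
  by rewrite (gabor_multiplier_commutes hLam VP Ll) hVK.
Qed.
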